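(* Let $p,q\ge 1$, let $l$ be an even positive integer, let $\begin{pmatrix}a&b\\c&d\end{pmatrix}\in GRAV(\mathbb{R}^{p+q})$ and let $\boldsymbol{y}=\varphi(\boldsymbol{x})=(a\boldsymbol{x}+b)(c\boldsymbol{x}+d)^{-1}$ be the induced Möbius transformation. Let $f$ be a sufficiently smooth (class $C^l$) $\mathcal{C}l_{p+q}$-valued function over a domain $U\subset\mathbb{R}^{p+q}\setminus\mathbb{R}^p$. Then, for all $\boldsymbol{x}$ with $\boldsymbol{y}=\varphi(\boldsymbol{x})\in U$, $$G_{\boldsymbol{y}}^lf(\boldsymbol{y})=|c\boldsymbol{x}+d|^{p+1+l}\,G_{\boldsymbol{x}}^l\left[|c\boldsymbol{x}+d|^{-p-1+l}\,f\big((a\boldsymbol{x}+b)(c\boldsymbol{x}+d)^{-1}\big)\right].$$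
   Context: $\mathcal{C}l_{p+q}$ is the real Clifford algebra generated by an orthonormal basis $e_1,\dots,e_{p+q}$ of $\mathbb{R}^{p+q}$ with $e_ie_j+e_je_i=-2\delta_{ij}$; vectors are identified with elements $\boldsymbol{x}=\sum_{i=1}^{p+q} x_ie_i$. For $a=\sum_A a_Ae_A\in\mathcal{C}l_{p+q}$, $|a|=(\sum_A a_A^2)^{1/2}$. Write $\boldsymbol{x}=\boldsymbol{x}_p+\boldsymbol{x}_q\in\mathbb{R}^p\oplus\mathbb{R}^q$ with $\boldsymbol{x}_p=\sum_{i=1}^p x_ie_i$, $\boldsymbol{x}_q=\sum_{i=p+1}^{p+q}x_ie_i$; $\mathbb{R}^p$ is regarded as the subset $\{\boldsymbol{x}_q=0\}$ of $\mathbb{R}^{p+q}$. The global slice Dirac operator is $$G_{\boldsymbol{x}}=\sum_{i=1}^pe_i\partial_{x_i}+\frac{\boldsymbol{x}_q}{|\boldsymbol{x}_q|^2}\sum_{i=p+1}^{p+q}x_i\partial_{x_i},$$ acting on $\mathcal{C}l_{p+q}$-valued functions (Clifford coefficients multiply from the left). $G_{\boldsymbol{x}}^l$ is its $l$-fold iterate, and $G_{\boldsymbol{y}}$ is the same operator in the variable $\boldsymbol{y}$. $GRAV(\mathbb{R}^{p+q})$ is the group of $2\times2$ matrices over $\mathcal{C}l_{p+q}$ generated by $$\begin{pmatrix}1&\boldsymbol{b}\\0&1\end{pmatrix},\quad\begin{pmatrix}\lambda&0\\0&\lambda^{-1}\end{pmatrix},\quad\begin{pmatrix}\boldsymbol{a}&0\\0&\boldsymbol{a}^{-1}\end{pmatrix},\quad\begin{pmatrix}0&1\\-1&0\end{pmatrix},$$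 where $\boldsymbol{b}\in\mathbb{R}^p$, $\lambda\in\mathbb{R}\setminus\{0\}$, and $\boldsymbol{a}\in\mathbb{S}^{q-1}$, the unit sphere of the summand $\mathbb{R}^q$. A matrix $\begin{pmatrix}a&b\\c&d\end{pmatrix}$ in this group acts on $\mathbb{R}^{p+q}\cup\{\infty\}$ by the Möbius transformation $\boldsymbol{x}\mapsto(a\boldsymbol{x}+b)(c\boldsymbol{x}+d)^{-1}$. *)

(* Defs.v *)
From HB Require Import structures.
From mathcomp Require Import all_boot all_order all_algebra.
From mathcomp Require Import all_classical all_reals all_analysis.
From mathcomp Require Import ring.

Set Implicit Arguments.
Unset Strict Implicit.
Unset Printing Implicit Defensive.

Import Order.TTheory GRing.Theory Num.Theory.
Import numFieldNormedType.Exports.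
Local Open Scope ring_scope.

(* The family of coordinates (a_A) of a = \sum_A a_A e_A, where
   e_A = e_{i_1} ... e_{i_k} for A = {i_1 < ... < i_k}.  This is a separate
   type because {ffun _ -> R} already carries the pointwise product. *)
Definition clifford (R : realType) (n : nat) : Type := {ffun {set 'I_n} -> R}.

HB.instance Definition _ (R : realType) n :=
  GRing.Lmodule.copy (clifford R n) {ffun {set 'I_n} -> R}.

Definition symd (T : finType) (A B : {set T}) : {set T} :=
  (A :\: B) :|: (B :\: A).

(* e_A e_B = cl_sign A B *: e_(symd A B): sorting the concatenated word costs
   a factor -1 for each pair i > j with i \in A and j \in B, and each i in the
   intersection of A and B contributes e_i ^+ 2 = -1. *)
Definition cl_sign (R : realType) (n : nat) (A B : {set 'I_n}) : R :=
  \prod_(i in A) \prod_(j in B) (if (j <= i)%N then -1 else 1).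

Definition cl_blade (R : realType) (n : nat) (A : {set 'I_n}) : clifford R n :=
  [ffun B => (B == A)%:R].

(* The bilinear extension of the rule above: e_A * e_B contributes to the
   coordinate C exactly when B = symd A C. *)
Definition cl_mul (R : realType) (n : nat) (a b : clifford R n) : clifford R n :=
  [ffun C => \sum_A cl_sign R A (symd A C) * a A * b (symd A C)].

Section CliffordRing.
Variables (R : realType) (n : nat).
Implicit Types (A B C : {set 'I_n}) (a b c : clifford R n).

Let in_symd (T : finType) (A B : {set T}) x :
  (x \in symd A B) = (x \in A) (+) (x \in B).
Proof. by rewrite !inE; case: (x \in A); case: (x \in B). Qed.

Let symdA (T : finType) : associative (@symd T).
Proof. by move=> A B C; apply/setP => x; rewrite !in_symd addbA. Qed.

Let symdC (T : finType) : commutative (@symd T).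
Proof. by move=> A B; apply/setP => x; rewrite !in_symd addbC. Qed.

Let symdK (T : finType) (A : {set T}) : involutive (symd A).
Proof.
by move=> B; apply/setP => x; rewrite !in_symd addbA addbb.
Qed.

Let sym0d (T : finType) : left_id finset.set0 (@symd T).
Proof. by move=> A; apply/setP => x; rewrite in_symd finset.in_set0. Qed.

Let prod_symd (T : finType) (A B : {set T}) (g : T -> R) :
  (forall i, g i * g i = 1) ->
  \prod_(i in symd A B) g i = (\prod_(i in A) g i) * (\prod_(i in B) g i).
Proof.
move=> g1; rewrite big_mkcond [X in _ = X * _]big_mkcond [X in _ = _ * X]big_mkcond.
rewrite -big_split /=; apply: eq_bigr => i _.
by rewrite in_symd; case: (i \in A); case: (i \in B);
  rewrite /= ?mulr1 ?mul1r ?g1.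
Qed.

Let sgn1 (b : bool) : (if b then -1 else 1 : R) * (if b then -1 else 1) = 1.
Proof. by case: b; rewrite ?mulrNN mulr1. Qed.

Let cl_signDr A B C : cl_sign R A (symd B C) = cl_sign R A B * cl_sign R A C.
Proof.
rewrite /cl_sign -big_split; apply: eq_bigr => i _.
by rewrite prod_symd // => j; exact: sgn1.
Qed.

Let cl_signDl A B C : cl_sign R (symd A B) C = cl_sign R A C * cl_sign R B C.
Proof.
rewrite /cl_sign prod_symd // => i; rewrite -big_split big1 // => j _.
exact: sgn1.
Qed.

Let cl_sign0l B : cl_sign R finset.set0 B = 1.
Proof. by rewrite /cl_sign big_set0. Qed.

Let cl_sign0r A : cl_sign R A finset.set0 = 1.
Proof. by rewrite /cl_sign big1 // => i _; rewrite big_set0. Qed.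

Fact cl_mulA : associative (@cl_mul R n).
Proof.
move=> a b c; apply/ffunP => D; rewrite !ffunE.
under eq_bigr do rewrite ffunE mulr_sumr.
under [RHS]eq_bigr do rewrite ffunE mulr_sumr mulr_suml.
rewrite [RHS]exchange_big /=; apply: eq_bigr => A _.
rewrite [RHS](reindex_inj (can_inj (symdK A))) /=; apply: eq_bigr => B _.
rewrite symdK (symdC A B) -symdA; set E := symd B (symd A D).
have -> : symd A D = symd B E by rewrite /E symdK.
by rewrite cl_signDr cl_signDl; ring.
Qed.

Fact cl_mul1l : left_id (cl_blade R finset.set0) (@cl_mul R n).
Proof.
move=> a; apply/ffunP => C; rewrite ffunE (bigD1 finset.set0) //= big1 => [|A /negPf nA].
  by rewrite ffunE eqxx cl_sign0l sym0d !mul1r addr0.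
by rewrite ffunE nA mulr0 mul0r.
Qed.

Fact cl_mul1r : right_id (cl_blade R finset.set0) (@cl_mul R n).
Proof.
move=> a; apply/ffunP => C; rewrite ffunE (bigD1 C) //= big1 => [|A nA].
  have -> : symd C C = finset.set0 by apply/setP => x; rewrite in_symd addbb finset.in_set0.
  by rewrite ffunE eqxx cl_sign0r mul1r mulr1 addr0.
rewrite ffunE; case: eqP => [e|]; last by rewrite mulr0.
by case/eqP: nA; rewrite -(symdK A C) e symdC sym0d.
Qed.

Fact cl_mulDl : left_distributive (@cl_mul R n) +%R.
Proof.
move=> a b c; apply/ffunP => C; rewrite !ffunE -big_split /=.
by apply: eq_bigr => A _; rewrite ffunE mulrDr mulrDl.
Qed.

Fact cl_mulDr : right_distributive (@cl_mul R n) +%R.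
Proof.
move=> a b c; apply/ffunP => C; rewrite !ffunE -big_split /=.
by apply: eq_bigr => A _; rewrite ffunE mulrDr.
Qed.

Fact cl_one_neq0 : cl_blade R finset.set0 != 0 :> clifford R n.
Proof.
apply/eqP => /ffunP /(_ finset.set0); rewrite !ffunE eqxx => /eqP.
by rewrite oner_eq0.
Qed.

HB.instance Definition _ := GRing.Zmodule_isNzRing.Build (clifford R n)
  cl_mulA cl_mul1l cl_mul1r cl_mulDl cl_mulDr cl_one_neq0.

Fact cl_scalerAl (k : R) a b : k *: (a * b) = (k *: a) * b.
Proof.
apply/ffunP => C; rewrite !ffunE scaler_sumr; apply: eq_bigr => A _.
by rewrite ffunE /GRing.scale /= !mulrA (mulrC k).
Qed.

HB.instance Definition _ :=
  GRing.Lmodule_isLalgebra.Build R (clifford R n) cl_scalerAl.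

Fact cl_scalerAr (k : R) a b : k *: (a * b) = a * (k *: b).
Proof.
apply/ffunP => C; rewrite !ffunE scaler_sumr; apply: eq_bigr => A _.
by rewrite ffunE /GRing.scale /= !mulrA (mulrC k) -!mulrA (mulrCA k).
Qed.

HB.instance Definition _ :=
  GRing.Lalgebra_isAlgebra.Build R (clifford R n) cl_scalerAr.

Definition cl_unit : pred (clifford R n) :=
  fun a => `[< exists b, b * a = 1 /\ a * b = 1 >].

Definition cl_inv a : clifford R n :=
  if pselect (exists b, b * a = 1 /\ a * b = 1) is left h
  then projT1 (cid h) else a.

Fact cl_mulVr : {in cl_unit, left_inverse 1 cl_inv *%R}.
Proof.
move=> a /asboolP ua; rewrite /cl_inv; case: pselect => // h.
by case: (cid h) => b [].
Qed.

Fact cl_divrr : {in cl_unit, right_inverse 1 cl_inv *%R}.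
Proof.
move=> a /asboolP ua; rewrite /cl_inv; case: pselect => // h.
by case: (cid h) => b [].
Qed.

Fact cl_unitrP a b : b * a = 1 /\ a * b = 1 -> cl_unit a.
Proof. by move=> h; apply/asboolP; exists b. Qed.

Fact cl_invr_out : {in [predC cl_unit], cl_inv =1 id}.
Proof.
move=> a /negP ua; rewrite /cl_inv; case: pselect => // h.
by case: ua; apply/asboolP.
Qed.

HB.instance Definition _ := GRing.NzRing_hasMulInverse.Build (clifford R n)
  cl_mulVr cl_divrr cl_unitrP cl_invr_out.

Let sym_blade A B : cl_blade R A * cl_blade R B =
  cl_sign R A B *: cl_blade R (symd A B).
Proof.
apply/ffunP => C; rewrite !ffunE (bigD1 A) //= big1 => [|D /negPf nD]; last first.
  by rewrite ffunE nD mulr0 mul0r.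
rewrite !ffunE eqxx mulr1 addr0 /GRing.scale /=.
have -> : (symd A C == B) = (C == symd A B).
  by apply/eqP/eqP => [<-|->]; rewrite symdK.
by case: eqP => [->|_]; rewrite ?symdK // !mulr0.
Qed.

Definition cl_e (i : 'I_n) : clifford R n := cl_blade R [set i].

Lemma cl_e_anticomm i j :
  cl_e i * cl_e j + cl_e j * cl_e i = - (2 * (i == j)%:R) *: 1.
Proof.
rewrite !sym_blade (symdC [set j]) -scalerDl /cl_sign !big_set1.
have [<-|nij] := eqVneq i j.
  rewrite leqnn mulr1 -opprD; congr (_ *: _).
  by apply/ffunP => B; rewrite !ffunE; congr (_ == _)%:R; apply/setP => x;
    rewrite in_symd addbb finset.in_set0.
rewrite mulr0 oppr0 scale0r; case: ltngtP => [_|_|/ord_inj/eqP] /=.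
- by rewrite addNr scale0r.
- by rewrite subrr scale0r.
- by rewrite eq_sym (negPf nij).
Qed.

(* Blades are the increasing products of the generators. *)
Lemma cl_bladeE A : cl_blade R A = \prod_(i <- enum A) cl_e i.
Proof.
have sA : sorted ltn (map val (enum A)).
  apply: (subseq_sorted ltn_trans _ (iota_ltn_sorted 0 n)).
  by rewrite -val_enum_ord; apply: map_subseq; rewrite enumT; exact: filter_subseq.
have {1}-> : A = [set x in enum A] by apply/setP => x; rewrite inE mem_enum.
elim: (enum A) sA => [_|i s IHs].
  by rewrite big_nil; congr cl_blade; apply/setP => x; rewrite !inE.
rewrite [sorted _ _]/= (path_sortedE ltn_trans) => /andP[/allP lts sS].
rewrite big_cons -IHs // sym_blade /cl_sign big_set1 big1 => [|j js].
  rewrite scale1r; congr cl_blade; apply/setP => x; rewrite in_symd !inE.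
  case: eqP => //= ->; apply/esym/negP => xs.
  by have := lts _ (map_f val xs); rewrite /= ltnn.
rewrite inE in js.
by have := lts _ (map_f val js); rewrite ltnNge => /negPf /= ->.
Qed.

End CliffordRing.

Arguments cl_e R {n} i.

Definition cl_norm (R : realType) (n : nat) (a : clifford R n) : R :=
  Num.sqrt (\sum_A a A ^+ 2).

Definition cl_vec (R : realType) (n : nat) (x : 'rV[R]_n) : clifford R n :=
  \sum_i x 0 i *: cl_e R i.

Definition cl_vecpart (R : realType) (n : nat) (a : clifford R n) : 'rV[R]_n :=
  \row_i a [set i].

Lemma cl_vecK (R : realType) (n : nat) : cancel (@cl_vec R n) (@cl_vecpart R n).
Proof.
move=> x; apply/rowP => i; rewrite mxE sum_ffunE (bigD1 i) //= big1 => [|j nji].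
  by rewrite !ffunE eqxx /GRing.scale /= mulr1 addr0.
rewrite !ffunE; case: eqP => [/set1_inj ij|_]; last by rewrite scaler0.
by rewrite ij eqxx in nji.
Qed.

Local Open Scope classical_set_scope.

Definition cl_partial (R : realType) (m n : nat) (i : 'I_m)
    (f : 'rV[R]_m -> clifford R n) (x : 'rV[R]_m) : clifford R n :=
  [ffun A => 'D_(delta_mx 0 i) (fun z => f z A) x].

(* A point of R^(p+q) is x = row_mx x_p x_q, with x_p = lsubmx x and
   x_q = rsubmx x.  Where x_q = 0 the second summand is the junk value 0. *)
Definition slice_dirac (R : realType) (p q : nat)
    (f : 'rV[R]_(p + q) -> clifford R (p + q)) (x : 'rV[R]_(p + q)) :
    clifford R (p + q) :=
  let xq := cl_vec (row_mx 0 (rsubmx x)) in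
  \sum_(i < p) cl_e R (lshift q i) * cl_partial (lshift q i) f x +
  ((cl_norm xq ^+ 2)^-1 *: xq) *
    \sum_(i < q) x 0 (rshift p i) *: cl_partial (rshift p i) f x.

Fixpoint is_Ck (R : realType) (n k : nat) (U : set 'rV[R]_n)
    (g : 'rV[R]_n -> R) : Prop :=
  (forall x, U x -> {for x, continuous g}) /\
  (if k is k'.+1 then
     forall i : 'I_n, (forall x, U x -> derivable g x (delta_mx 0 i)) /\
       is_Ck k' U (fun x => 'D_(delta_mx 0 i) g x)
   else True).

Definition cl_is_Ck (R : realType) (m n k : nat) (U : set 'rV[R]_m)
    (f : 'rV[R]_m -> clifford R n) : Prop :=
  forall A, is_Ck k U (fun x => f x A).

Definition is_domain (R : realType) (n : nat) (U : set 'rV[R]_n) : Prop :=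
  [/\ open U, connected U & U !=set0].

Definition Rp_subset (R : realType) (p q : nat) : set 'rV[R]_(p + q) :=
  [set x | rsubmx x = 0].

Definition mx2 (T : Type) (a b c d : T) : 'M[T]_2 :=
  \matrix_(i, j) if i == ord0 then (if j == ord0 then a else b)
                 else (if j == ord0 then c else d).

Inductive GRAV (R : realType) (p q : nat) : 'M[clifford R (p + q)]_2 -> Prop :=
| GRAV_translation (b : 'rV[R]_p) :
    GRAV (mx2 1 (cl_vec (row_mx b 0)) 0 1)
| GRAV_dilation (lambda : R) : lambda != 0 ->
    GRAV (mx2 lambda%:A 0 0 (lambda^-1)%:A)
| GRAV_sphere (a : 'rV[R]_q) : cl_norm (cl_vec (row_mx 0 a : 'rV[R]_(p + q))) = 1 ->
    GRAV (mx2 (cl_vec (row_mx 0 a)) 0 0 (cl_vec (row_mx 0 a))^-1)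
| GRAV_inversion : GRAV (mx2 0 1 (-1) 0)
| GRAV_one : GRAV 1%:M
| GRAV_mul M N : GRAV M -> GRAV N -> GRAV (M *m N)
| GRAV_inv M N : GRAV M -> M *m N = 1%:M -> N *m M = 1%:M -> GRAV N.

(* The finite value at x, meaningful where c x + d is invertible (elsewhere the
   image is infinity).  For a matrix in GRAV the product is then a vector, so
   cl_vecpart only reads it as a point of R^n. *)
Definition moebius (R : realType) (n : nat) (a b c d : clifford R n)
    (x : 'rV[R]_n) : 'rV[R]_n :=
  cl_vecpart ((a * cl_vec x + b) * (c * cl_vec x + d)^-1).

(* Main.v *)
Require Import Defs.
From HB Require Import structures.
From mathcomp Require Import all_boot all_order all_algebra.
From mathcomp Require Import all_classical all_reals all_analysis.
From mathcomp Require Import ring lra.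

(* Write x = x_p + r w with r = |x_q| and w = x_q / r, and let d_i be the derivative
   along the orthonormal frame e_1, ..., e_p, w. The frame is constant along its own
   directions, so G = sum_i a_i d_i with pairwise anticommuting a_i of square -1 and
   commuting d_i; hence G^2 = - L, where L = sum_i d_i^2 is the Laplacian of the
   half-plane R^p + R_+ w, acting on each Clifford coordinate separately.  For l = 2k
   the claim becomes the covariance of L^k, with the weights of the polyharmonic
   operator in dimension p + 1, and this property is stable under composition.
   Translations, dilations and reflections are immediate.  For the inversion s one
   proves
     L^k (|x|^(2k-p-1) f(s x)) = |x|^(-2k-p-1) (L^k f)(s x)
   by induction on k, from the formula for L^(k+1)(|x|^2 g) in terms of L^k g.
   A matrix of the group is a product of generators, and every generator preserves
   the complement of R^p, so that no intermediate image of a point outside R^p is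
   infinite; a point of R^p is excluded by following its image in homogeneous
   coordinates. *)

Import Order.TTheory GRing.Theory Num.Theory.
Import numFieldNormedType.Exports.
Local Open Scope classical_set_scope.
Local Open Scope ring_scope.

Set Implicit Arguments.
Unset Strict Implicit.
Unset Printing Implicit Defensive.

(** * Mean value theorem and functions with continuous partial derivatives *)

(** Two obstacles shape the proof. The hypothesis on [f] speaks of iterated partial derivatives,
    while the frame varies with the point and [f] is composed with maps; hence the passage to
    Fréchet differentiability ([smooth]) and the symmetry of second derivatives. Moreover the
    dimension [p + q] must not enter the formulas: the calculus uses an abstract frame indexed by a
    finite type, and [p + 1] arises only as the cardinal of [option 'I_p]. The inversion formula
    rests on the commutators [[L, N] = 4 E + 2 d] and [[L, E] = 2 L], where [N = |x|^2], [E] is the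
    Euler operator and [d = p + 1]. The exponent [- 2 k - d] is the one for which the terms without
    [L] cancel in the induction step. The Clifford norm is not multiplicative in general, but each
    generator multiplies the denominator on the left by a real or a vector, up to sign, and for such
    factors it is. So [|c x + d|] obeys the cocycle rule by which covariant maps compose, and the
    entries of a general matrix of the group need no description. *)

Section PartialDerivatives.
Variables (R : realType) (n : nat).
Implicit Types (f g : 'rV[R]_n -> R) (x z v : 'rV[R]_n).

Lemma is_derive_line f z v (s : R) : derivable f (z + s *: v) v ->
  is_derive s 1 (fun t => f (z + t *: v)) ('D_v f (z + s *: v)).
Proof.
move=> df.
have e : (fun h : R => h^-1 *: (f (z + (h *: 1 + s) *: v) - f (z + s *: v))) =
         (fun h : R => h^-1 *: (f (h *: v + (z + s *: v)) - f (z + s *: v))).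
  apply/funext => h; congr (_ *: (f _ - _)).
  by rewrite [h *: 1]mulr1 scalerDl addrCA.
by split; rewrite /derivable /derive /= ?e.
Qed.

(** Bounding [c] by absolute value absorbs the sign of [t] and the degenerate case [t = 0], so that
    callers never orient the segment. *)
Lemma MVT_line f z v (t : R) :
  (forall c : R, `|c| <= `|t| -> derivable f (z + c *: v) v) ->
  exists2 c : R, `|c| <= `|t| & f (z + t *: v) - f z = t * 'D_v f (z + c *: v).
Proof.
move=> df; set phi := fun s : R => f (z + s *: v).
have dphi (c : R) : `|c| <= `|t| -> is_derive c (1 : R) (phi : R -> R) ('D_v f (z + c *: v)).
  by move=> ct; exact/is_derive_line/df.
have phi0 : phi 0 = f z by rewrite /phi scale0r addr0.
have cphi (a b : R) : `|a| <= `|t| -> `|b| <= `|t| -> {within `[a, b], continuous phi}.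
  move=> at_ bt; apply: derivable_within_continuous => s; rewrite in_itv /= => /andP[sa sb].
  have st : `|s| <= `|t|.
    move: at_ bt; rewrite !ler_norml => /andP[ta _] /andP[_ bt].
    by rewrite (le_trans ta sa) (le_trans sb bt).
  by have [] := dphi s st.
case: (ltrgtP t 0) => [t0|t0|->].
- have [|c|c] := @MVT R phi (fun c => 'D_v f (z + c *: v)) t 0 t0.
  + move=> c; rewrite in_itv /= => /andP[tc c0]; apply: dphi.
    by rewrite !ltr0_norm // lerN2 ltW.
  + by apply: cphi; rewrite ?normr0.
  rewrite in_itv /= => /andP[tc c0] e; exists c.
    by rewrite !ltr0_norm // lerN2 ltW.
  by rewrite -phi0 -[f _]/(phi t) -opprB e; ring.
- have [|c|c] := @MVT R phi (fun c => 'D_v f (z + c *: v)) 0 t t0.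
  + move=> c; rewrite in_itv /= => /andP[tc c0]; apply: dphi.
    by rewrite !gtr0_norm // ltW.
  + by apply: cphi; rewrite ?normr0.
  rewrite in_itv /= => /andP[tc c0] e; exists c.
    by rewrite !gtr0_norm // ltW.
  by rewrite -phi0 -[f _]/(phi t) e; ring.
- by exists 0; rewrite // scale0r addr0 mul0r subrr.
Qed.

Lemma rV_norm_coord x i : `|x 0 i| <= `|x|.
Proof. by rewrite /Num.norm /= mx_normrE (le_bigmax _ _ (0, i)). Qed.

Lemma rV_norm_le x (e : R) : 0 <= e -> (forall i, `|x 0 i| <= e) -> `|x| <= e.
Proof.
move=> e0 h; rewrite /Num.norm /= mx_normrE; apply: bigmax_le => // -[i j] _ /=.
by rewrite (ord1 i).
Qed.

(** The increment from [x] to [x + h] is split along the axes, one coordinate at a time. On each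
    piece the mean value theorem gives a partial derivative at a point within [|h|] of [x], which
    continuity compares with its value at [x]. *)
Lemma partials_differentiable (U : set 'rV[R]_n) f x :
  open U -> U x -> (forall i z, U z -> derivable f z (delta_mx 0 i)) ->
  (forall i, {for x, continuous (fun z => 'D_(delta_mx 0 i) f z)}) ->
  differentiable f x.
Proof.
move=> oU Ux df cf.
(* [h_ h j] keeps the first [j] coordinates of [h]: these are the corners of the path from [0] to
   [h]. *)
pose h_ (h : 'rV[R]_n) (j : nat) : 'rV[R]_n := \row_i (if (i < j)%N then h 0 i else 0).
pose L : 'rV[R]_n -> R := fun h => \sum_i h 0 i * 'D_(delta_mx 0 i) f x.
have linL : linear L.
  move=> k u v; rewrite /L scaler_sumr -big_split /=; apply: eq_bigr => i _.
  by rewrite !mxE /GRing.scale /=; ring.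
pose Lm := GRing.isLinear.Build R 'rV[R]_n R *:%R L linL.
pose LL : {linear 'rV[R]_n -> R} := HB.pack L Lm.
have cL : continuous LL.
  apply: continuous_big => [|i _ z]; first exact: add_continuous.
  apply: (@continuousM _ _ (fun h : 'rV[R]_n => h 0 i) (cst _)); last exact: cst_continuous.
  exact: coord_continuous.
have ef : (f : 'rV[R]_n -> R^o) \o shift x = cst (f x) + (LL : 'rV[R]_n -> R^o) +o_ (0 : 'rV[R]_n) id.
  apply/eqaddoP => e e0.
  (* There are [n] pieces, each with error at most [e' * |h|]; the divisor [n.+1] also covers
     [n = 0]. *)
  pose e' := e / n.+1%:R.
  have e'0 : 0 < e' by rewrite divr_gt0.
  have : \forall z \near x, U z /\ forall i, `|'D_(delta_mx 0 i) f x - 'D_(delta_mx 0 i) f z| <= e'.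
    apply: filterI; first exact: open_nbhs_nbhs.
    apply: (@filter_forall _ _ (fun i z => `|'D_(delta_mx 0 i) f x - 'D_(delta_mx 0 i) f z| <= e') (nbhs x)) => i.
    have /cvgrPdist_le /(_ _ e'0) := cf i.
    exact.
  move=> /nbhs_ballP[d /= d0 Hd].
  apply/nbhs_ballP; exists d => //= h.
  rewrite mx_norm_ball /ball_ /= sub0r normrN => hd.
  have Hz z : `|z - x| <= `|h| -> U z /\ forall i, `|'D_(delta_mx 0 i) f x - 'D_(delta_mx 0 i) f z| <= e'.
    move=> zh; apply: Hd; rewrite mx_norm_ball /ball_ /= distrC.
    exact: le_lt_trans zh hd.
  have h0 : h_ h 0%N = 0 by apply/rowP => i; rewrite !mxE.
  have hn : h_ h n = h by apply/rowP => i; rewrite !mxE ltn_ord.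
  have hS (j : 'I_n) : h_ h j.+1 = h_ h j + h 0 j *: delta_mx 0 j.
    apply/rowP => i; rewrite !mxE eqxx /= ltnS leq_eqVlt orbC.
    have [->|ij] := eqVneq i j; first by rewrite ltnn eqxx add0r mulr1.
    by rewrite mulr0 addr0 (_ : (i == j :> nat) = false) ?orbF //; exact/negbTE.
  have tel : f (h + x) - f x = \sum_(j < n) (f (h_ h j.+1 + x) - f (h_ h j + x)).
    rewrite -(big_mkord xpredT (fun j => f (h_ h j.+1 + x) - f (h_ h j + x))).
    by rewrite (telescope_sumr (fun j => f (h_ h j + x))) // hn h0 add0r.
  have step (j : 'I_n) : `|f (h_ h j.+1 + x) - f (h_ h j + x) -
      h 0 j * 'D_(delta_mx 0 j) f x| <= `|h| * e'.
    have near_seg (c : R) : `|c| <= `|h 0 j| ->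
        `|h_ h j + x + c *: delta_mx 0 j - x| <= `|h|.
      move=> ch; rewrite addrAC addrK; apply: rV_norm_le => // i.
      rewrite !mxE eqxx /=; have [->|ij] := eqVneq i j.
        by rewrite ltnn add0r mulr1 (le_trans ch) // rV_norm_coord.
      by rewrite mulr0 addr0; case: ifP => _; rewrite ?normr0 ?rV_norm_coord.
    have [|c ch] := @MVT_line f (h_ h j + x) (delta_mx 0 j) (h 0 j).
      by move=> c ch; apply: df; exact: (Hz _ (near_seg c ch)).1.
    rewrite addrAC -hS => ->; rewrite -mulrBr normrM.
    apply: ler_pM => //; first exact: rV_norm_coord.
    rewrite distrC; exact: (Hz _ (near_seg c ch)).2.
  change (`|f (h + x) - (f x + L h)| <= e * `|h|).
  rewrite opprD addrA tel /L -sumrB (le_trans (ler_norm_sum _ _ _)) //.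
  apply: (@le_trans _ _ (\sum_(j < n) `|h| * e')); first exact: ler_sum.
  rewrite sumr_const card_ord -mulrnAr mulrC ler_wpM2r // /e' -mulr_natr.
  by rewrite mulrAC ler_pdivrMr // ler_pM2l // ler_nat.
have dL : 'd f x = LL :> ('rV[R]_n -> R) by exact: diff_unique.
by apply/diff_locallyP; rewrite dL.
Qed.

End PartialDerivatives.

(** * Rules for directional derivatives of real functions *)

Section DirectionalRules.
Variables (R : realType) (n : nat).
Implicit Types (f g : 'rV[R]_n -> R) (x v : 'rV[R]_n).

Lemma derive_add f g x v : differentiable f x -> differentiable g x ->
  'D_v (fun z => f z + g z) x = 'D_v f x + 'D_v g x.
Proof. by move=> df dg; apply: (@deriveD _ _ _ f g); exact: diff_derivable. Qed.

Lemma derive_mul f g x v : differentiable f x -> differentiable g x ->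
  'D_v (fun z => f z * g z) x = f x * 'D_v g x + g x * 'D_v f x.
Proof. by move=> df dg; apply: (@deriveM _ _ f g); exact: diff_derivable. Qed.

Lemma derive_const (c : R) x v : 'D_v (fun=> c) x = 0.
Proof. exact: derive_cst. Qed.

Lemma derive_mulc (c : R) f x v : differentiable f x ->
  'D_v (fun z => c * f z) x = c * 'D_v f x.
Proof.
by move=> df; rewrite (@derive_mul (fun=> c)) ?derive_const ?mulr0 ?addr0 //.
Qed.

Lemma derive_inv f x v : differentiable f x -> f x != 0 ->
  'D_v (fun z => (f z)^-1) x = - (f x) ^- 2 * 'D_v f x.
Proof. by move=> df fx; rewrite (@deriveV _ _ f) //; exact: diff_derivable. Qed.

Lemma derive_coord i x v : 'D_v (fun z : 'rV[R]_n => z 0 i) x = v 0 i.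
Proof.
have := derive_id x v.
rewrite derive_mx; last exact: derivable_id.
by move=> /rowP /(_ i); rewrite mxE.
Qed.

Lemma derive_partials f x v : differentiable f x ->
  'D_v f x = \sum_i v 0 i * 'D_(delta_mx 0 i) f x.
Proof.
move=> df; rewrite deriveE // {1}(row_sum_delta v) linear_sum.
by apply: eq_bigr => i _; rewrite linearZ deriveE.
Qed.

Lemma diff_add f g x : differentiable f x -> differentiable g x ->
  differentiable (fun z => f z + g z) x.
Proof. exact: (@differentiableD _ _ _ f g). Qed.

Lemma diff_mul f g x : differentiable f x -> differentiable g x ->
  differentiable (fun z => f z * g z) x.
Proof. exact: (@differentiableM _ _ f g). Qed.

Lemma diff_const (c : R) x : differentiable (fun=> c : R) x.
Proof. exact: differentiable_cst. Qed.

Lemma diff_sum (I : Type) (r : seq I) (F : I -> 'rV[R]_n -> R) x :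
  (forall i, differentiable (F i) x) ->
  differentiable (fun z => \sum_(i <- r) F i z) x.
Proof.
move=> dF; elim: r => [|i r IHr].
  by under eq_fun do rewrite big_nil; exact: diff_const.
by under eq_fun do rewrite big_cons; exact: diff_add.
Qed.

Lemma derive_bigsum (I : Type) (r : seq I) (F : I -> 'rV[R]_n -> R) x v :
  (forall i, differentiable (F i) x) ->
  'D_v (fun z => \sum_(i <- r) F i z) x = \sum_(i <- r) 'D_v (F i) x.
Proof.
move=> dF; elim: r => [|i r IHr].
  by under eq_fun do rewrite big_nil; rewrite big_nil derive_const.
under eq_fun do rewrite big_cons.
by rewrite big_cons derive_add ?IHr //; exact: diff_sum.
Qed.

(** Integer exponents are needed because the weights [-p-1+l] take both signs. *)
Lemma derive_expz f x v (m : int) : differentiable f x -> f x != 0 ->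
  'D_v (fun z => f z ^ m) x = m%:~R * f x ^ (m - 1) * 'D_v f x.
Proof.
move=> df fx.
have dfv : derivable f x v by exact: diff_derivable.
case: m => m.
  rewrite (_ : (fun z => f z ^ Posz m) = f ^+ m); last by apply/funext => z; rewrite exprfctE.
  rewrite (@deriveX _ _ f) //= /GRing.scale /=; case: m => [|m]; first by rewrite !mul0r.
  by rewrite intS addrAC subrr add0r.
rewrite (_ : (fun z => f z ^ Negz m) = (fun z => ((f ^+ m.+1) z)^-1)); last first.
  by apply/funext => z; rewrite exprfctE.
have fxm : (f ^+ m.+1) x != 0 by rewrite exprfctE expf_neq0.
rewrite (@deriveV _ _ (f ^+ m.+1)) //; last exact: derivableX.
rewrite deriveX // /GRing.scale /= exprfctE mulrA; congr (_ * _).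
rewrite (_ : Negz m - 1 = - m.+2%:Z); last by rewrite NegzE -opprD -PoszD addn1.
rewrite NegzE rmorphN /= !mulNr mulrCA; congr (- (_ * _)).
rewrite -invr_expz -[f x ^ m.+2]/(f x ^+ m.+2) (exprD _ 2 m) (exprS _ m).
by field; rewrite fx expf_neq0.
Qed.

End DirectionalRules.

(** * Functions of class C^k *)

(** Unlike [is_Ck], each level asks for Fréchet differentiability, so that derivatives in arbitrary
    directions and compositions are governed by the chain rule. *)
Fixpoint smooth (R : realType) (n k : nat) (U : set 'rV[R]_n) (f : 'rV[R]_n -> R) : Prop :=
  if k is k'.+1 then
    (forall x, U x -> differentiable f x) /\
    forall i, smooth k' U (fun x => 'D_(delta_mx 0 i) f x)
  else forall x, U x -> {for x, continuous f}.

Section Smooth.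
Variables (R : realType) (n : nat).
Implicit Types (f g : 'rV[R]_n -> R) (x v : 'rV[R]_n) (U V : set 'rV[R]_n).

Lemma smooth_differentiable k U f x : smooth k.+1 U f -> U x -> differentiable f x.
Proof. by case=> df _; exact: df. Qed.

Lemma smooth_continuous k U f x : smooth k U f -> U x -> {for x, continuous f}.
Proof.
case: k => [|k] sf Ux; first exact: sf.
exact/differentiable_continuous/(smooth_differentiable sf).
Qed.

Lemma smoothW k U f : smooth k.+1 U f -> smooth k U f.
Proof.
elim: k f => [|k IHk] f sf; first by move=> x; exact: smooth_continuous sf.
by case: sf => df sf; split=> // i; exact: IHk.
Qed.

Lemma smooth_le k m U f : (k <= m)%N -> smooth m U f -> smooth k U f.
Proof.
move=> /subnK <-; elim: (m - k)%N => // d IHd; rewrite addSn => /smoothW; exact: IHd.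
Qed.

Lemma smooth_sub k U V f : V `<=` U -> smooth k U f -> smooth k V f.
Proof.
move=> VU; elim: k f => [|k IHk] f /= sf; first by move=> x /VU; exact: sf.
by case: sf => df sf; split=> [x /VU/df//|i]; exact: IHk.
Qed.

Lemma near_open U x (P : 'rV[R]_n -> Prop) : open U -> U x ->
  (forall z, U z -> P z) -> \forall z \near x, P z.
Proof. by move=> oU Ux UP; apply: filterS UP _; exact: open_nbhs_nbhs. Qed.

Lemma derive_eq_on U f g x v : open U -> U x -> (forall z, U z -> f z = g z) ->
  'D_v f x = 'D_v g x.
Proof. by move=> oU Ux fg; apply: near_eq_derive; exact: near_open fg. Qed.

(** Differentiability is local: the differential of [f] also serves for [g], since the remainder
    estimate is only needed for increments that stay in a ball inside [U]. *)
Lemma differentiable_eq_on U f g x : open U -> U x -> (forall z, U z -> f z = g z) ->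
  differentiable f x -> differentiable g x.
Proof.
move=> oU Ux fg df.
have [d /= d0 Hd] : nbhs_ball x U by apply/nbhs_ballP; exact: open_nbhs_nbhs.
have [cL /eqaddoP fL] : continuous ('d f x) /\
    (f : 'rV[R]_n -> R^o) \o shift x = cst (f x) + ('d f x : 'rV[R]_n -> R^o) +o_ (0 : 'rV[R]_n) id.
  exact/diff_locallyP.
have gL : (g : 'rV[R]_n -> R^o) \o shift x =
    cst (g x) + ('d f x : 'rV[R]_n -> R^o) +o_ (0 : 'rV[R]_n) id.
  apply/eqaddoP => e e0; have := fL e e0; apply: filter_app.
  apply/nbhs_ballP; exists d => //= h hd.
  have Uhx : U (h + x).
    by apply: Hd; move: hd; rewrite !mx_norm_ball /ball_ /= sub0r opprD addrCA subrr addr0.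
  change (`|f (h + x) - (f x + 'd f x h)| <= e * `|h| ->
    `|g (h + x) - (g x + 'd f x h)| <= e * `|h|).
  by rewrite -(fg _ Ux) -(fg _ Uhx).
have dL := diff_unique cL gL.
by apply/diff_locallyP; rewrite dL.
Qed.

Lemma smooth_eq k U f g : open U -> (forall z, U z -> f z = g z) ->
  smooth k U f -> smooth k U g.
Proof.
move=> oU; elim: k f g => [|k IHk] f g fg sf.
  move=> x Ux; suff : g @ x --> g x by [].
  rewrite -(fg _ Ux); apply: cvg_trans (sf x Ux); apply: (@near_eq_cvg _ _ (nbhs x) _ f g); exact: near_open fg.
case: sf => df sf; split=> [x Ux|i]; first exact: differentiable_eq_on oU Ux fg (df x Ux).
apply: IHk (sf i) => z Uz; exact: derive_eq_on oU Uz fg.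
Qed.

Lemma smooth_const k U (c : R) : smooth k U (fun=> c).
Proof.
elim: k c => [|k IHk] c /=; first by move=> x _; exact: cst_continuous.
split=> [x _|i]; first exact: diff_const.
by under eq_fun do rewrite derive_const; exact: IHk.
Qed.

Lemma smooth_coord k U i : smooth k U (fun x => x 0 i).
Proof.
case: k => [|k] /=; first by move=> x _; exact: coord_continuous.
split=> [x _|j]; first exact: differentiable_coord.
by under eq_fun do rewrite derive_coord; exact: smooth_const.
Qed.

Lemma smooth_add k U f g : open U -> smooth k U f -> smooth k U g ->
  smooth k U (fun x => f x + g x).
Proof.
move=> oU; elim: k f g => [|k IHk] f g sf sg.
  by move=> x Ux; apply: (@continuousD _ _ _ f g); [exact: sf|exact: sg].
case: sf sg => df sf [dg sg]; split=> [x Ux|i].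
  by apply: diff_add; [exact: df|exact: dg].
apply: (smooth_eq oU _ (IHk _ _ (sf i) (sg i))) => x Ux /=.
by rewrite derive_add //; [exact: df|exact: dg].
Qed.

Lemma smooth_mul k U f g : open U -> smooth k U f -> smooth k U g ->
  smooth k U (fun x => f x * g x).
Proof.
move=> oU; elim: k f g => [|k IHk] f g sf sg.
  by move=> x Ux; apply: (@continuousM _ _ f g); [exact: sf|exact: sg].
have [sf' sg'] := (smoothW sf, smoothW sg).
case: sf sg => df sf [dg sg]; split=> [x Ux|i].
  by apply: diff_mul; [exact: df|exact: dg].
apply: (smooth_eq oU _ (smooth_add oU (IHk _ _ sf' (sg i)) (IHk _ _ sg' (sf i)))) => x Ux /=.
by rewrite derive_mul //; [exact: df|exact: dg].
Qed.

Lemma smooth_sum (I : Type) (r : seq I) k U (F : I -> 'rV[R]_n -> R) : open U ->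
  (forall i, smooth k U (F i)) -> smooth k U (fun x => \sum_(i <- r) F i x).
Proof.
move=> oU sF; elim: r => [|i r IHr].
  by under eq_fun do rewrite big_nil; exact: smooth_const.
by under eq_fun do rewrite big_cons; exact: smooth_add.
Qed.

Lemma smooth_inv k U f : open U -> (forall x, U x -> f x != 0) -> smooth k U f ->
  smooth k U (fun x => (f x)^-1).
Proof.
move=> oU f0; elim: k f f0 => [|k IHk] f f0 sf.
  by move=> x Ux; apply: (@continuousV _ _ f); [exact: f0|exact: sf].
have sf' := smoothW sf; case: sf => df sf; split=> [x Ux|i].
  by apply: differentiableV; [exact: df|exact: f0].
have sI := IHk _ f0 sf'.
(* The factor [- 1 / f ^ 2] is written with two copies of [1 / f], to which the induction hypothesis
   applies. *)
have sN := smooth_mul oU (smooth_const k U (-1)) (smooth_mul oU sI sI).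
apply: (smooth_eq oU _ (smooth_mul oU sN (sf i))) => x Ux /=.
rewrite derive_inv; [|exact: df|exact: f0].
by rewrite mulN1r -invfM -expr2.
Qed.

Lemma sqrt_differentiable f x : differentiable f x -> 0 < f x ->
  differentiable (fun z => Num.sqrt (f z)) x.
Proof.
move=> df f0; apply: (@differentiable_comp _ _ _ _ f (@Num.sqrt R)) => //.
by apply/derivable1_diffP; have [] := is_derive1_sqrt f0.
Qed.

Lemma derive_sqrt f x v : differentiable f x -> 0 < f x ->
  'D_v (fun z => Num.sqrt (f z)) x = (2 * Num.sqrt (f x))^-1 * 'D_v f x.
Proof.
move=> df f0.
have dsq : differentiable (@Num.sqrt R) (f x).
  by apply/derivable1_diffP; have [] := is_derive1_sqrt f0.
rewrite !deriveE //; last exact: sqrt_differentiable.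
rewrite (@diff_comp _ _ _ _ f (@Num.sqrt R)) //=.
have ds := is_derive1_sqrt f0.
have e := @derive_val _ _ _ _ _ _ _ ds.
by rewrite diff1E // derive1E e /= [RHS]mulrC.
Qed.

Lemma smooth_sqrt k U f : open U -> (forall x, U x -> 0 < f x) -> smooth k U f ->
  smooth k U (fun x => Num.sqrt (f x)).
Proof.
move=> oU f0; elim: k f f0 => [|k IHk] f f0 sf.
  move=> x Ux; apply: (@continuous_comp _ _ _ f (@Num.sqrt R)); first exact: sf.
  exact: sqrt_continuous.
have sf' := smoothW sf; case: sf => df sf; split=> [x Ux|i].
  by apply: sqrt_differentiable; [exact: df|exact: f0].
have s2 : smooth k U (fun x => 2 * Num.sqrt (f x)).
  by apply: smooth_mul => //; [exact: smooth_const|exact: IHk].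
have sI : smooth k U (fun x => (2 * Num.sqrt (f x))^-1).
  by apply: smooth_inv => // x Ux; rewrite mulf_neq0 // gt_eqF // sqrtr_gt0 f0.
apply: (smooth_eq oU _ (smooth_mul oU sI (sf i))) => x Ux /=.
by rewrite derive_sqrt //; [exact: df|exact: f0].
Qed.

Lemma smooth_expz k U f (m : int) : open U -> (forall x, U x -> f x != 0) ->
  smooth k U f -> smooth k U (fun x => f x ^ m).
Proof.
move=> oU f0 sf.
have sX j : smooth k U (fun x => f x ^+ j).
  elim: j => [|j IHj]; first exact: smooth_const.
  by under eq_fun do rewrite exprS; exact: smooth_mul.
case: m => j; first exact: sX.
by apply: smooth_inv => // x /f0; exact: expf_neq0.
Qed.

(** By induction the first partial derivatives are smooth of order [k], hence continuous, and
    continuous partial derivatives give differentiability. *)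
Lemma is_Ck_smooth k U f : open U -> is_Ck k U f -> smooth k U f.
Proof.
move=> oU; elim: k f => [|k IHk] f; first by case.
case=> cf df; split=> [x Ux|i]; last exact: IHk (df i).2.
apply: (partials_differentiable oU Ux) => [i z|i]; first exact: (df i).1.
exact: smooth_continuous (IHk _ (df i).2) Ux.
Qed.

End Smooth.

(** * Vector-valued maps and the chain rule *)

Lemma continuous_rV (R : realType) (T : topologicalType) (n : nat) (phi : T -> 'rV[R]_n) x :
  (forall j, {for x, continuous (fun z => phi z 0 j)}) -> {for x, continuous phi}.
Proof.
move=> cphi; suff : phi @ x --> phi x by [].
apply/cvgrPdist_le => e e0.
have H : \forall z \near x, forall j, `|phi x 0 j - phi z 0 j| <= e.
  apply: (@filter_forall _ _ (fun j z => `|phi x 0 j - phi z 0 j| <= e) (nbhs x)) => j.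
  have /cvgrPdist_le/(_ _ e0) := cphi j; exact.
apply: filterS H => z Hz; apply: rV_norm_le (ltW e0) _ => j.
by rewrite !mxE.
Qed.

Lemma differentiable_rV (R : realType) (m n : nat) (phi : 'rV[R]_m -> 'rV[R]_n) x :
  (forall j, differentiable (fun z => phi z 0 j) x) -> differentiable phi x.
Proof.
move=> dphi.
have -> : phi = \sum_(j < n) (fun z => phi z 0 j *: delta_mx 0 j).
  by apply/funext => z; rewrite fct_sumE {1}(row_sum_delta (phi z)).
apply: differentiable_sum => j; exact: differentiableZl.
Qed.

Lemma derive_chain (R : realType) (m n : nat) (phi : 'rV[R]_m -> 'rV[R]_n)
    (f : 'rV[R]_n -> R) x v :
  differentiable f (phi x) -> (forall j, differentiable (fun z => phi z 0 j) x) ->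
  'D_v (fun z => f (phi z)) x =
  \sum_j 'D_v (fun z => phi z 0 j) x * 'D_(delta_mx 0 j) f (phi x).
Proof.
move=> df dphi; have dp := differentiable_rV dphi.
rewrite deriveE; last exact: (differentiable_comp dp df).
rewrite (@diff_comp _ _ _ _ phi f) //= -!deriveE //.
rewrite derive_partials //; apply: eq_bigr => j _.
by rewrite derive_mx ?mxE //; exact: diff_derivable.
Qed.

Lemma smooth_comp (R : realType) (m n k : nat) (U : set 'rV[R]_m) (V : set 'rV[R]_n)
    (phi : 'rV[R]_m -> 'rV[R]_n) f :
  open U -> (forall x, U x -> V (phi x)) -> (forall j, smooth k U (fun x => phi x 0 j)) ->
  smooth k V f -> smooth k U (fun x => f (phi x)).
Proof.
move=> oU UV; elim: k f => [|k IHk] f sphi sf.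
  move=> x Ux; apply: (@continuous_comp _ _ _ phi f); last exact/sf/UV.
  by apply: continuous_rV => j; exact: sphi.
have [df sdf] := sf; split=> [x Ux|i].
  apply: (@differentiable_comp _ _ _ _ phi f); last exact/df/UV.
  by apply: differentiable_rV => j; exact: smooth_differentiable (sphi j) Ux.
apply: (@smooth_eq _ _ k U (fun x => \sum_j 'D_(delta_mx 0 i) (fun z => phi z 0 j) x *
   'D_(delta_mx 0 j) f (phi x))) => //.
  move=> x Ux; rewrite derive_chain //; first exact/df/UV.
  by move=> j; exact: smooth_differentiable (sphi j) Ux.
apply: smooth_sum => // j; apply: smooth_mul => //; first exact: (sphi j).2.
apply: (IHk ('D_(delta_mx 0 j) f)) (sdf j) => l; exact: smoothW (sphi l).
Qed.

(** * Symmetry of second derivatives *)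

Section Schwarz.
Variables (R : realType) (n : nat).
Implicit Types (f g : 'rV[R]_n -> R) (x u v w : 'rV[R]_n) (U : set 'rV[R]_n).

Lemma shift_growth f x u w :
  (fun h : R => h^-1 *: (((fun y => f (y + w)) \o shift x) (h *: u) - f (x + w))) =
  (fun h : R => h^-1 *: ((f \o shift (x + w)) (h *: u) - f (x + w))).
Proof. by apply/funext => h /=; rewrite addrA. Qed.

Lemma derivable_shift f x u w : derivable f (x + w) u -> derivable (fun y => f (y + w)) x u.
Proof. by rewrite /derivable /= shift_growth. Qed.

Lemma derive_shiftr f x u w : 'D_u (fun y => f (y + w)) x = 'D_u f (x + w).
Proof. by rewrite /derive /= shift_growth. Qed.

(** The mean value theorem is applied first in direction [u] to the increment of [f] by [t *: v],
    then in direction [v] to ['D_u f]. The left side is symmetric in [u] and [v], which is the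
    source of the symmetry of mixed derivatives. *)
Lemma MVT_second_difference U f x u v (t : R) :
  (forall c c' : R, `|c| <= `|t| -> `|c'| <= `|t| -> U (x + c *: u + c' *: v)) ->
  (forall z, U z -> derivable f z u) -> (forall z, U z -> derivable ('D_u f) z v) ->
  exists c c' : R, [/\ `|c| <= `|t|, `|c'| <= `|t| &
    f (x + t *: u + t *: v) - f (x + t *: u) - (f (x + t *: v) - f x) =
    t * t * 'D_v ('D_u f) (x + c *: u + c' *: v)].
Proof.
move=> HU df ddf.
have HU0 c : `|c| <= `|t| -> U (x + c *: u).
  by move=> ct; have := HU c 0 ct; rewrite normr0 scale0r addr0; apply.
pose g := fun y => f (y + t *: v) - f y.
have dg c : `|c| <= `|t| -> derivable (fun y => f (y + t *: v)) (x + c *: u) u.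
  by move=> ct; apply/derivable_shift/df/HU.
have [c ct|c ct e] := @MVT_line _ _ g x u t.
  by apply: (@derivableB _ _ _ (fun y => f (y + t *: v)) f); [exact: dg|exact/df/HU0].
have [c' ct'|c' ct' e'] := @MVT_line _ _ ('D_u f) (x + c *: u) v t.
  exact/ddf/HU.
exists c, c'; split=> //; rewrite -mulrA -e' -derive_shiftr.
rewrite /g in e; rewrite [LHS]e.
rewrite (@deriveB _ _ _ (fun y => f (y + t *: v)) f) //; first exact: dg.
exact/df/HU0.
Qed.

Lemma near_common_limit (P Q Y Z e : R) :
  `|Q - Y| <= e / 2 -> `|P - Z| <= e / 2 -> Y = Z -> `|P - Q| <= e.
Proof. by rewrite !ler_norml => /andP[? ?] /andP[? ?] ?; lra. Qed.

(** One second difference is evaluated in both orders. After division by [t * t] the two mixed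
    derivatives agree at two points near [x], perhaps distinct, and continuity puts each within
    [e / 2] of its value at [x]. *)
Lemma schwarz U f x i j : open U -> U x -> smooth 2 U f ->
  'D_(delta_mx 0 i) ('D_(delta_mx 0 j) f) x = 'D_(delta_mx 0 j) ('D_(delta_mx 0 i) f) x.
Proof.
move=> oU Ux sf; set u : 'rV[R]_n := delta_mx 0 i; set v : 'rV[R]_n := delta_mx 0 j.
have [df sdf] := sf.
have ddf l z w : U z -> derivable ('D_(delta_mx 0 l) f) z w.
  by move=> Uz; apply: diff_derivable; exact: (sdf l).1.
have cdf l m : {for x, continuous ('D_(delta_mx 0 m) ('D_(delta_mx 0 l) f))}.
  by apply: (smooth_continuous (k := 0) (U := U)) => //; exact: (sdf l).2.
apply/eqP; rewrite -subr_eq0 -normr_le0; apply/ler_addgt0Pl => e e0; rewrite addr0.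
have e20 : 0 < e / 2 by rewrite divr_gt0.
have : \forall z \near x, U z /\ (`|'D_u ('D_v f) x - 'D_u ('D_v f) z| <= e / 2 /\
    `|'D_v ('D_u f) x - 'D_v ('D_u f) z| <= e / 2).
  apply: filterI; first exact: open_nbhs_nbhs.
  apply: filterI.
    by have /cvgrPdist_le/(_ _ e20) := cdf j i.
  by have /cvgrPdist_le/(_ _ e20) := cdf i j.
move=> /nbhs_ballP[d /= d0 Hd].
(* Two steps of length at most [t] add up to at most [2 d / 3], inside the ball of radius [d] even
   when [i = j]. *)
pose t := d / 3.
have t0 : 0 < t by rewrite divr_gt0.
have nu l : `|delta_mx 0 l : 'rV[R]_n| <= 1.
  apply: rV_norm_le => // k; rewrite !mxE eqxx /=.
  by case: eqP => _; rewrite ?normr1 ?normr0.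
have Hball l m (c c' : R) : `|c| <= `|t| -> `|c'| <= `|t| ->
    ball x d (x + c *: (delta_mx 0 l : 'rV[R]_n) + c' *: delta_mx 0 m).
  move=> ct ct'; rewrite mx_norm_ball /ball_ /= -addrA opprD addNKr normrN.
  apply: (le_lt_trans (ler_normD _ _)); rewrite !normrZ.
  have h1 : `|c| * `|delta_mx 0 l : 'rV[R]_n| <= t.
    by rewrite -[leRHS]mulr1 ler_pM // (le_trans ct) // gtr0_norm.
  have h2 : `|c'| * `|delta_mx 0 m : 'rV[R]_n| <= t.
    by rewrite -[leRHS]mulr1 ler_pM // (le_trans ct') // gtr0_norm.
  by apply: (le_lt_trans (lerD h1 h2)); rewrite /t; lra.
have [| | |c [c' [ct ct' e1]]] := @MVT_second_difference U f x u v t.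
- by move=> c c' ct ct'; exact: (Hd _ (Hball i j c c' ct ct')).1.
- by move=> z Uz; exact/diff_derivable/df.
- by move=> z Uz; exact: ddf.
have [| | |k [k' [kt kt' e2]]] := @MVT_second_difference U f x v u t.
- by move=> k k' kt kt'; exact: (Hd _ (Hball j i k k' kt kt')).1.
- by move=> z Uz; exact/diff_derivable/df.
- by move=> z Uz; exact: ddf.
have e12 : 'D_v ('D_u f) (x + c *: u + c' *: v) = 'D_u ('D_v f) (x + k *: v + k' *: u).
  move: e1 e2; rewrite (addrAC x (t *: v)).
  move: ('D_v ('D_u f) (x + c *: u + c' *: v)) ('D_u ('D_v f) (x + k *: v + k' *: u)).
  move: (f (x + t *: u + t *: v)) (f (x + t *: u)) (f (x + t *: v)) (f x).
  move=> A B C F Y Z e1 e2.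
  have e3 : t * t * Y = t * t * Z by rewrite -e1 -e2; ring.
  by apply: (mulfI _ e3); rewrite mulf_neq0 // gt_eqF.
have [_ [_ H1]] := Hd _ (Hball i j c c' ct ct').
have [_ [H2 _]] := Hd _ (Hball j i k k' kt kt').
exact: (near_common_limit H1 H2 e12).
Qed.

End Schwarz.

(** * The Laplacian of a parallel orthonormal frame *)

Definition rv_sqnorm (R : realType) (n : nat) (x : 'rV[R]_n) : R := \sum_m x 0 m ^+ 2.

Section Frame.
Variables (R : realType) (n : nat) (I : finType).
Variables (W : set 'rV[R]_n) (a : I -> 'rV[R]_n -> 'rV[R]_n).
Implicit Types (f g : 'rV[R]_n -> R) (x v : 'rV[R]_n) (U V : set 'rV[R]_n) (i j : I).

Definition fr_coord i x : R := \sum_m x 0 m * a i x 0 m.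
Definition fr_der i f x : R := 'D_(a i x) f x.
Definition fr_euler f x : R := \sum_i fr_coord i x * fr_der i f x.
Definition fr_lap f x : R := \sum_i fr_der i (fr_der i f) x.

(** By [fr_span] the position vector lies in the span of the frame, so the [fr_coord i] act as
    Cartesian coordinates of a space of dimension [#|I|], whatever [n] is. By [fr_scale] the frame
    does not change under positive rescaling, and in particular not under the inversion, which moves
    each point along its ray. *)
Record parallel_frame : Prop := ParallelFrame {
  fr_open : open W;
  fr_neq0 : forall x, W x -> x != 0;
  fr_smooth : forall k i m, smooth k W (fun x => a i x 0 m);
  fr_orth : forall x i j, W x -> \sum_m a i x 0 m * a j x 0 m = (i == j)%:R;
  fr_parallel : forall x i j m, W x -> fr_der i (fun z => a j z 0 m) x = 0;
  fr_span : forall x m, W x -> x 0 m = \sum_i fr_coord i x * a i x 0 m;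
  fr_scale : forall x (c : R), W x -> 0 < c -> W (c *: x) /\ forall i, a i (c *: x) = a i x
}.

Hypothesis fr : parallel_frame.
Local Notation X := fr_coord.
Local Notation D := fr_der.
Local Notation E := fr_euler.
Local Notation L := fr_lap.
Local Notation N := (@rv_sqnorm R n).
Local Notation d := (#|I|%:R : R).

Section OnOpen.
Variable U : set 'rV[R]_n.
Hypotheses (oU : open U) (UW : U `<=` W).

Let sa k i m : smooth k U (fun x => a i x 0 m).
Proof. exact/(smooth_sub UW)/fr_smooth. Qed.

Let diffa i m x : U x -> differentiable (fun z => a i z 0 m) x.
Proof. exact: smooth_differentiable (sa 1 i m). Qed.

Lemma fr_der_partials i f x : differentiable f x ->
  D i f x = \sum_m a i x 0 m * 'D_(delta_mx 0 m) f x.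
Proof. exact: derive_partials. Qed.

Lemma fr_der_eq i f g : (forall x, U x -> f x = g x) -> forall x, U x -> D i f x = D i g x.
Proof. by move=> fg x Ux; exact: derive_eq_on oU Ux fg. Qed.

Lemma fr_lap_eq f g : (forall x, U x -> f x = g x) -> forall x, U x -> L f x = L g x.
Proof.
move=> fg x Ux; apply: eq_bigr => i _; apply: fr_der_eq Ux => z Uz.
exact: fr_der_eq Uz.
Qed.

Lemma fr_euler_eq f g : (forall x, U x -> f x = g x) -> forall x, U x -> E f x = E g x.
Proof. by move=> fg x Ux; apply: eq_bigr => i _; congr (_ * _); exact: fr_der_eq Ux. Qed.

Lemma fr_iter_lap_eq k f g : (forall x, U x -> f x = g x) ->
  forall x, U x -> iter k L f x = iter k L g x.
Proof.
move=> fg; elim: k => [|k IHk] x Ux; first exact: fg.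
by rewrite !iterS; exact: (fr_lap_eq IHk Ux).
Qed.

Lemma smooth_fr_der k i f : smooth k.+1 U f -> smooth k U (D i f).
Proof.
move=> sf; apply: (@smooth_eq _ _ _ _ (fun x => \sum_m a i x 0 m * 'D_(delta_mx 0 m) f x)) => //.
  by move=> x Ux; rewrite fr_der_partials //; exact: smooth_differentiable sf Ux.
by apply: smooth_sum => // m; apply: smooth_mul => //; exact: sf.2.
Qed.

Lemma smooth_fr_coord k i : smooth k U (X i).
Proof.
by apply: smooth_sum => // m; apply: smooth_mul => //; exact: smooth_coord.
Qed.

Lemma smooth_fr_lap k f : smooth k.+2 U f -> smooth k U (L f).
Proof. by move=> sf; apply: smooth_sum => // i; exact/smooth_fr_der/smooth_fr_der. Qed.

Lemma smooth_fr_euler k f : smooth k.+1 U f -> smooth k U (E f).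
Proof.
move=> sf; apply: smooth_sum => // i; apply: smooth_mul => //; last exact: smooth_fr_der.
exact: smooth_fr_coord.
Qed.

Lemma smooth_iter_fr_lap k m f : smooth (k.*2 + m) U f -> smooth m U (iter k L f).
Proof.
elim: k m => [|k IHk] m //; rewrite doubleS !addSn -!addnS => /IHk.
exact: smooth_fr_lap.
Qed.

Let dif k f x : smooth k.+1 U f -> U x -> differentiable f x.
Proof. exact: smooth_differentiable. Qed.

(** In [D i (D j f)] the terms that differentiate the frame vanish by parallelism; what remains is
    the second differential of [f] on two frame vectors, which is symmetric. *)
Lemma fr_derC i j f x : smooth 2 U f -> U x -> D i (D j f) x = D j (D i f) x.
Proof.
move=> sf Ux.
have step s t : D s (D t f) x =
    \sum_l \sum_m a t x 0 l * a s x 0 m * 'D_(delta_mx 0 m) ('D_(delta_mx 0 l) f) x.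
  rewrite (@fr_der_eq s _ (fun x => \sum_l a t x 0 l * 'D_(delta_mx 0 l) f x)) //; last first.
    by move=> z Uz; apply: fr_der_partials; exact: dif sf Uz.
  have dpf l : differentiable ('D_(delta_mx 0 l) f) x by exact: (@dif 0 _ _ (sf.2 l) Ux).
  rewrite /fr_der derive_bigsum => [|l]; last by apply: diff_mul => //; exact: diffa.
  apply: eq_bigr => l _; rewrite derive_mul //; last exact: diffa.
  rewrite [X in _ + _ * X](_ : _ = 0) ?mulr0 ?addr0; last exact/fr_parallel/UW.
  by rewrite derive_partials // mulr_sumr; apply: eq_bigr => m _; rewrite mulrA.
rewrite !step exchange_big /=; apply: eq_bigr => l _; apply: eq_bigr => m _.
by rewrite (schwarz _ _ oU Ux sf) (mulrC (a j x 0 m)).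
Qed.

Lemma fr_der_coord i j x : U x -> D i (X j) x = (i == j)%:R.
Proof.
move=> Ux; rewrite /fr_der derive_bigsum => [|m]; last first.
  by apply: diff_mul; [exact: differentiable_coord|exact: diffa].
rewrite -(fr_orth fr i j (UW Ux)); apply: eq_bigr => m _.
rewrite derive_mul; [|exact: differentiable_coord|exact: diffa].
rewrite derive_coord [X in _ * X + _](_ : _ = 0) ?mulr0 ?add0r; last exact/fr_parallel/UW.
by rewrite mulrC.
Qed.

(** Expanding the position vector in the frame identifies [E] with the ambient Euler operator, whose
    direction at [x] is [x] itself. *)
Lemma fr_euler_partials f x : differentiable f x -> U x ->
  E f x = \sum_m x 0 m * 'D_(delta_mx 0 m) f x.
Proof.
move=> df Ux; under [RHS]eq_bigr do rewrite {1}(fr_span fr _ (UW Ux)) mulr_suml.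
rewrite exchange_big; apply: eq_bigr => i _.
by rewrite fr_der_partials // mulr_sumr; apply: eq_bigr => m _; rewrite mulrA.
Qed.

Lemma fr_sqnorm x : U x -> \sum_i X i x ^+ 2 = N x.
Proof.
move=> Ux; apply/esym; rewrite /rv_sqnorm.
under eq_bigr => m _ do rewrite expr2 {2}(fr_span fr _ (UW Ux)) mulr_sumr.
rewrite exchange_big; apply: eq_bigr => i _.
by rewrite expr2 {3}/fr_coord mulr_sumr; apply: eq_bigr => m _; rewrite mulrCA.
Qed.

Lemma sqnorm_gt0 x : x != 0 -> 0 < N x.
Proof.
move=> x0; rewrite lt_def sumr_ge0 ?andbT => [|m _]; last exact: sqr_ge0.
apply: contra x0 => /eqP N0; apply/eqP/rowP => m; rewrite mxE; apply/eqP.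
rewrite -sqrf_eq0; apply/eqP.
by move: m isT; apply: psumr_eq0P N0 => m _; exact: sqr_ge0.
Qed.

Lemma fr_sqnorm_gt0 x : U x -> 0 < N x.
Proof. by move=> /UW /(fr_neq0 fr); exact: sqnorm_gt0. Qed.

Lemma smooth_sqnorm k : smooth k U N.
Proof.
by apply: smooth_sum => // m; under eq_fun do rewrite expr2; apply: smooth_mul => //;
  exact: smooth_coord.
Qed.

Lemma fr_der_sqnorm i x : D i N x = 2 * X i x.
Proof.
rewrite [LHS]derive_bigsum => [|m]; last first.
  by under eq_fun do rewrite expr2; apply: diff_mul; exact: differentiable_coord.
rewrite mulr_sumr; apply: eq_bigr => m _; under eq_fun do rewrite expr2.
by rewrite derive_mul ?derive_coord; try exact: differentiable_coord; ring.
Qed.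

Lemma fr_lap_add f g x : smooth 2 U f -> smooth 2 U g -> U x ->
  L (fun z => f z + g z) x = L f x + L g x.
Proof.
move=> sf sg Ux; rewrite -big_split; apply: eq_bigr => i _.
rewrite (@fr_der_eq i _ (fun z => D i f z + D i g z)) //; last first.
  by move=> z Uz; apply: derive_add; [exact: dif sf Uz|exact: dif sg Uz].
apply: derive_add; [exact: dif (smooth_fr_der i sf) Ux|exact: dif (smooth_fr_der i sg) Ux].
Qed.

Lemma fr_lap_mulc (c : R) f x : smooth 2 U f -> U x ->
  L (fun z => c * f z) x = c * L f x.
Proof.
move=> sf Ux; rewrite mulr_sumr; apply: eq_bigr => i _.
rewrite (@fr_der_eq i _ (fun z => c * D i f z)) //; last first.
  by move=> z Uz; apply: derive_mulc; exact: dif sf Uz.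
by apply: derive_mulc; exact: dif (smooth_fr_der i sf) Ux.
Qed.

Lemma fr_euler_mul f g x : differentiable f x -> differentiable g x ->
  E (fun z => f z * g z) x = f x * E g x + g x * E f x.
Proof.
move=> df dg; rewrite !mulr_sumr -big_split; apply: eq_bigr => i _.
by rewrite /fr_der derive_mul //=; ring.
Qed.

Lemma fr_der_euler i f x : smooth 2 U f -> U x -> D i (E f) x = D i f x + E (D i f) x.
Proof.
move=> sf Ux; have dX j : differentiable (X j) x by exact: dif (smooth_fr_coord 1 j) Ux.
have dD j : differentiable (D j f) x by exact: dif (smooth_fr_der j sf) Ux.
rewrite /fr_der derive_bigsum => [|j]; last exact: diff_mul.
rewrite addrC (eq_bigr (fun j => X j x * D j (D i f) x + (i == j)%:R * D j f x)); last first.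
  by move=> j _; rewrite derive_mul // -(fr_derC i j) // -(fr_der_coord i j Ux) mulrC [in RHS]mulrC; congr (_ + _); rewrite mulrC.
rewrite big_split; congr (_ + _).
by rewrite (bigD1 i) //= eqxx mul1r big1 ?addr0 // => j /negPf ji; rewrite eq_sym ji mul0r.
Qed.

(** [E] measures the degree of homogeneity and [L] lowers it by two; concretely, each [D i] passing
    [E] leaves one extra [D i]. *)
Lemma fr_lap_euler f x : smooth 3 U f -> U x -> L (E f) x = E (L f) x + 2 * L f x.
Proof.
move=> sf Ux; have sf2 := smoothW sf.
have sD i := smooth_fr_der i sf.
have sDD i j := smooth_fr_der j (sD i).
have dDD i j : differentiable (D j (D i f)) x by exact: dif (sDD i j) Ux.
have step i : D i (D i (E f)) x = 2 * D i (D i f) x + E (D i (D i f)) x.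
  rewrite (@fr_der_eq i _ (fun z => D i f z + E (D i f) z)) //; last first.
    by move=> z Uz; exact: fr_der_euler.
  rewrite [LHS]derive_add; [|exact: dif (sD i) Ux|exact: dif (smooth_fr_euler (sD i)) Ux].
  rewrite [X in _ + X](fr_der_euler i (sD i) Ux) addrA; congr (_ + _).
  by rewrite mulr2n mulrDl mul1r.
rewrite [LHS](eq_bigr _ (fun i _ => step i)) big_split addrC -mulr_sumr; congr (_ + _).
rewrite exchange_big; apply: eq_bigr => j _.
by rewrite -mulr_sumr; congr (_ * _); rewrite [RHS]derive_bigsum.
Qed.

(** The weight is known only through the logarithmic derivative of [|x|^m], so that one computation
    serves both [N] itself ([m = 2]) and integer powers of its square root. The constant
    [m * (m + d - 2)] is that of the Laplacian of [|x|^m] in dimension [d]. *)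
Lemma fr_lap_weight (w g : 'rV[R]_n -> R) (m : R) x :
  smooth 2 U w -> (forall i z, U z -> D i w z = m * w z * X i z / N z) ->
  smooth 2 U g -> U x ->
  L (fun z => w z * g z) x =
  w x * (L g x + 2 * m / N x * E g x + m * (m + d - 2) / N x * g x).
Proof.
move=> sw dw sg Ux.
have N0 := fr_sqnorm_gt0 Ux; have N0' : N x != 0 by rewrite gt_eqF.
have dN : differentiable N x by exact: dif (smooth_sqnorm 1) Ux.
have dX i : differentiable (X i) x by exact: dif (smooth_fr_coord 1 i) Ux.
have dNi : differentiable (fun z => (N z)^-1) x by exact: differentiableV.
have step i : D i (D i (fun z => w z * g z)) x = w x * (D i (D i g) x + 2 * m / N x * (X i x * D i g x) +
     m * g x / N x + m * (m - 2) * g x / N x ^+ 2 * X i x ^+ 2).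
  rewrite (@fr_der_eq i _ (fun z => w z * D i g z + g z * (m * (w z * (X i z * (N z)^-1))))) //; last first.
    move=> z Uz; rewrite /fr_der derive_mul; [|exact: dif sw Uz|exact: dif sg Uz].
    by rewrite -/(D i w z) dw //; ring.
  have dwx : differentiable w x by exact: dif sw Ux.
  have dgx : differentiable g x by exact: dif sg Ux.
  have dDg : differentiable (D i g) x by exact: dif (smooth_fr_der i sg) Ux.
  have dXN : differentiable (fun z => X i z * (N z)^-1) x by exact: diff_mul.
  have dwXN : differentiable (fun z => w z * (X i z * (N z)^-1)) x by exact: diff_mul.
  have dmwXN : differentiable (fun z => m * (w z * (X i z * (N z)^-1))) x.
    by apply: diff_mul => //; exact: diff_const.
  rewrite {1}/fr_der derive_add; [|exact: diff_mul|exact: diff_mul].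
  have dm : differentiable (fun=> m : R) x by exact: diff_const.
  rewrite !derive_mul // derive_const derive_inv //.
  rewrite -!/(D i _ x) dw // fr_der_sqnorm // fr_der_coord // eqxx mulr1n.
  by field.
transitivity (w x * (L g x + 2 * m / N x * E g x + m * g x / N x * d +
    m * (m - 2) * g x / N x ^+ 2 * N x)).
  rewrite [LHS](eq_bigr _ (fun i _ => step i)) -mulr_sumr; congr (_ * _).
  rewrite !big_split; congr (_ + _ + _ + _).
  - by rewrite -mulr_sumr.
  - by rewrite sumr_const mulr_natr.
  - by rewrite -mulr_sumr fr_sqnorm.
move: (w x) (L g x) (E g x) (g x) (N x) N0' => *; by field.
Qed.

Lemma fr_lap_sqnorm_mul g x : smooth 2 U g -> U x ->
  L (fun z => N z * g z) x = N x * L g x + 4 * E g x + 2 * d * g x.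
Proof.
move=> sg Ux; have N0' : N x != 0 by rewrite gt_eqF // fr_sqnorm_gt0.
have dN i z : U z -> D i N z = 2 * N z * X i z / N z.
  move=> Uz; have Nz : N z != 0 by rewrite gt_eqF // fr_sqnorm_gt0.
  by rewrite fr_der_sqnorm // mulrAC mulfK.
apply: (etrans (fr_lap_weight (smooth_sqnorm 2) dN sg Ux)).
by move: (L g x) (E g x) (g x) (N x) N0' => *; field.
Qed.

(** Each further [L] meets [N] once, adding [4 E + 2 d], and commutes past the Euler term already
    there, adding [8 j] at stage [j]. The sum of [2 d + 8 j] over [j] from [0] to [k] is
    [2 (k + 1) (d + 2 k)]. *)
Lemma fr_iter_lap_sqnorm_mul k g x : smooth k.+1.*2 U g -> U x ->
  iter k.+1 L (fun z => N z * g z) x =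
  N x * iter k.+1 L g x + 4 * k.+1%:R * E (iter k L g) x +
  2 * k.+1%:R * (d + 2 * k%:R) * iter k L g x.
Proof.
elim: k x => [|k IHk] x sg Ux.
  by rewrite /= fr_lap_sqnorm_mul // !mulr0 addr0 !mulr1.
have sg' : smooth k.+1.*2 U g by apply: smooth_le sg; rewrite leq_double.
have s4 : smooth 4 U (iter k L g).
  by apply: smooth_iter_fr_lap; apply: smooth_le sg; rewrite !doubleS !addnS addn0.
set h := iter k L g in IHk s4 *; have sLh := smooth_fr_lap s4.
have s3 := smoothW s4; have s2 := smoothW s3; have sEh := smooth_fr_euler s3.
have smc c u : smooth 2 U u -> smooth 2 U (fun z => c * u z).
  by move=> su; exact: (smooth_mul oU (smooth_const 2 U c) su).
pose u1 := fun z => N z * L h z.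
pose u2 := fun z => 4 * k.+1%:R * E h z.
pose u3 := fun z => 2 * k.+1%:R * (d + 2 * k%:R) * h z.
have s1 : smooth 2 U u1 by exact: (smooth_mul oU (smooth_sqnorm 2) sLh).
have su2 : smooth 2 U u2 by exact: (smc _ _ sEh).
have su3 : smooth 2 U u3 by exact: (smc _ _ s2).
have su12 : smooth 2 U (fun z => u1 z + u2 z) by exact: (smooth_add oU s1 su2).
have IH z : U z -> iter k.+1 L (fun z => N z * g z) z = u1 z + u2 z + u3 z.
  by move=> Uz; exact: IHk.
have e0 : iter k.+2 L (fun z => N z * g z) x = L (fun z => u1 z + u2 z + u3 z) x.
  rewrite iterS. exact: (fr_lap_eq IH Ux).
have e1 := fr_lap_add su12 su3 Ux.
have e2 := fr_lap_add s1 su2 Ux.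
rewrite [LHS](etrans e0 (etrans e1 (congr1 (+%R^~ _) e2))).
rewrite (fr_lap_mulc _ sEh Ux) (fr_lap_mulc _ s2 Ux) (fr_lap_sqnorm_mul sLh Ux).
rewrite (fr_lap_euler s3 Ux).
transitivity (N x * L (L h) x + 4 * k.+2%:R * E (L h) x + 2 * k.+2%:R * (d + 2 * k.+1%:R) * L h x); last by [].
move: (L (L h) x) (E (L h) x) (L h x) (N x) => l e h0 n0.
have -> : k.+2%:R = k%:R + 2 :> R by rewrite -addn2 natrD.
have -> : k.+1%:R = k%:R + 1 :> R by rewrite -addn1 natrD.
by move: (k%:R : R) (#|I|%:R : R) => c1 c2; ring.
Qed.

End OnOpen.
End Frame.

(** This is the Clifford map [x] to [- x^-1], because [x^2 = - |x|^2]; hence the action of the last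
    generator of the group. *)
Definition rv_inversion (R : realType) (n : nat) (x : 'rV[R]_n) : 'rV[R]_n :=
  (rv_sqnorm x)^-1 *: x.

(** * Iterated Laplacian and inversion *)

Section Inversion.
Variables (R : realType) (n : nat) (I : finType).
Variables (W : set 'rV[R]_n) (a : I -> 'rV[R]_n -> 'rV[R]_n).
Hypothesis fr : parallel_frame W a.
Variables U V : set 'rV[R]_n.
Hypotheses (oU : open U) (UW : U `<=` W) (oV : open V) (VW : V `<=` W).
Local Notation X := (fr_coord a).
Local Notation D := (fr_der a).
Local Notation E := (fr_euler a).
Local Notation L := (fr_lap a).
Local Notation N := (@rv_sqnorm R n).
Local Notation d := (#|I|%:R : R).
Local Notation sg := (@rv_inversion R n).
Hypothesis UV : forall x, U x -> V (sg x).

Let N0 x : U x -> 0 < N x. Proof. exact: (fr_sqnorm_gt0 fr UW). Qed.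
Let Nn0 x : U x -> N x != 0. Proof. by move=> Ux; rewrite gt_eqF // N0. Qed.
Let sN k : smooth k U N. Proof. exact: (smooth_sqnorm oU). Qed.
Let sNi k : smooth k U (fun z => (N z)^-1). Proof. exact: smooth_inv. Qed.
Let dN x : U x -> differentiable N x.
Proof. exact: smooth_differentiable (sN 1). Qed.
Let dNi x : U x -> differentiable (fun z => (N z)^-1) x.
Proof. exact: smooth_differentiable (sNi 1). Qed.
Let dX i x : U x -> differentiable (X i) x.
Proof. exact: smooth_differentiable (smooth_fr_coord fr oU UW 1 i). Qed.

Let sgE m : (fun z => sg z 0 m) = (fun z => (N z)^-1 * z 0 m).
Proof. by apply/funext => z; rewrite mxE. Qed.

Lemma smooth_inversion k m : smooth k U (fun z => sg z 0 m).
Proof. by rewrite sgE; exact: (smooth_mul oU (sNi k) (smooth_coord k U m)). Qed.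

Lemma smooth_comp_inversion k f : smooth k V f -> smooth k U (fun z => f (sg z)).
Proof. by apply: smooth_comp => // j; exact: smooth_inversion. Qed.

Let dcomp f x : smooth 1 V f -> U x -> differentiable (fun z => f (sg z)) x.
Proof. by move=> sf; exact: smooth_differentiable (smooth_comp_inversion sf). Qed.

Let a_sg i x : U x -> a i (sg x) = a i x.
Proof. by move=> Ux; apply: (fr_scale fr (UW Ux) _).2; rewrite invr_gt0 N0. Qed.

Let X_sg i x : U x -> X i (sg x) = (N x)^-1 * X i x.
Proof.
move=> Ux; rewrite /fr_coord mulr_sumr; apply: eq_bigr => m _.
by rewrite a_sg // mxE mulrA.
Qed.

Let dVx f x : smooth 1 V f -> U x -> differentiable f (sg x).
Proof. by move=> sf Ux; exact: smooth_differentiable sf (UV Ux). Qed.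

Let sum_sg f x : U x -> \sum_i X i x * D i f (sg x) = N x * E f (sg x).
Proof.
move=> Ux; rewrite mulr_sumr; apply: eq_bigr => i _.
by rewrite X_sg // !mulrA mulfV ?mul1r // Nn0.
Qed.

(** The differential of the inversion is [1 / N] times the reflection along [x]; the reflected part
    is the Euler term. *)
Lemma fr_der_inversion i f x : smooth 1 V f -> U x ->
  D i (fun z => f (sg z)) x = (N x)^-1 * (D i f (sg x) - 2 * X i x * E f (sg x)).
Proof.
move=> sf Ux.
have Dsg m : D i (fun z => sg z 0 m) x =
    (N x)^-1 * a i x 0 m - 2 * X i x * (N x)^-1 * sg x 0 m.
  rewrite sgE [LHS]derive_mul; [|exact: dNi|exact: differentiable_coord].
  rewrite derive_coord (derive_inv _ (dN Ux) (Nn0 Ux)).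
  rewrite [X in _ + _ * (_ * X)](fr_der_sqnorm a i x) mxE.
  by move: (N x) (Nn0 Ux) => *; field.
rewrite [LHS]derive_chain; [|exact: dVx|]; last first.
  by move=> j; exact: smooth_differentiable (smooth_inversion 1 j) Ux.
rewrite (fr_euler_partials fr VW (dVx sf Ux) (UV Ux)).
rewrite (fr_der_partials a i (dVx sf Ux)) a_sg //.
rewrite mulr_sumr -sumrB mulr_sumr; apply: eq_bigr => m _.
by rewrite [X in X * _]Dsg; move: (sg x 0 m) ('D_(delta_mx 0 m) f (sg x)) => *; ring.
Qed.

(** The inversion turns scaling by [t] into scaling by [1 / t], which reverses the Euler field. *)
Lemma fr_euler_inversion f x : smooth 1 V f -> U x ->
  E (fun z => f (sg z)) x = - E f (sg x).
Proof.
move=> sf Ux.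
transitivity ((N x)^-1 * (\sum_i X i x * D i f (sg x) - 2 * E f (sg x) * \sum_i X i x ^+ 2)).
  rewrite mulr_sumr -sumrB mulr_sumr; apply: eq_bigr => i _.
  rewrite fr_der_inversion //.
  by move: (X i x) (D i f (sg x)) (E f (sg x)) (N x)^-1 => *; ring.
rewrite sum_sg // (fr_sqnorm fr UW Ux) .
by move: (N x) (Nn0 Ux) (E f (sg x)) => *; field.
Qed.

(** The two contributions of [E (E f)] cancel. The first-order remainder vanishes for [d = 2]; in
    other dimensions the weight has to compensate for it. *)
Lemma fr_lap_inversion f x : smooth 2 V f -> U x ->
  L (fun z => f (sg z)) x =
  (N x) ^- 2 * L f (sg x) + (4 - 2 * d) * (N x)^-1 * E f (sg x).
Proof.
move=> sf Ux; have sf1 := smoothW sf.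
have sE := smooth_fr_euler fr oV VW sf.
have sD i := smooth_fr_der fr oV VW i sf.
have sg1 := UV Ux.
have step i : D i (D i (fun z => f (sg z))) x =
    (N x)^-1 * ((N x)^-1 * D i (D i f) (sg x) +
      (- (2 * (N x)^-1)) * (X i x * D i (E f) (sg x)) + (- (2 * E f (sg x))) +
      (- 2) * (X i x * D i (fun z => E f (sg z)) x) +
      (4 * (N x)^-1 * E f (sg x)) * X i x ^+ 2).
  pose G z := D i f (sg z) + (-2) * (X i z * E f (sg z)).
  have eG z : U z -> D i (fun z => f (sg z)) z = (N z)^-1 * G z.
    by move=> Uz; rewrite fr_der_inversion // /G mulNr !mulrA.
  have dDc : differentiable (fun z => D i f (sg z)) x by exact: (dcomp (sD i) Ux).
  have dEc : differentiable (fun z => E f (sg z)) x by exact: (dcomp sE Ux).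
  have dXE : differentiable (fun z => X i z * E f (sg z)) x by exact: (diff_mul (dX i Ux) dEc).
  have dG : differentiable G x.
    by apply: (diff_add dDc); exact: (diff_mul (diff_const _ _) dXE).
  have hG : D i G x = D i (fun z => D i f (sg z)) x +
      (-2) * (X i x * D i (fun z => E f (sg z)) x + E f (sg x) * D i (X i) x).
    rewrite [LHS](derive_add _ dDc (diff_mul (diff_const _ _) dXE)) (derive_mulc _ _ dXE).
    by rewrite (derive_mul _ (dX i Ux) dEc).
  have hNG : D i (fun z => (N z)^-1 * G z) x =
      (N x)^-1 * D i G x + G x * (- (N x) ^- 2 * (2 * X i x)).
    rewrite [LHS](derive_mul _ (dNi Ux) dG) (derive_inv _ (dN Ux) (Nn0 Ux)).
    by rewrite -(fr_der_sqnorm a i x).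
  rewrite (fr_der_eq a oU i eG Ux) hNG hG (fr_der_inversion i (sD i) Ux).
  rewrite (fr_der_coord fr UW i i Ux) eqxx.
  have eE : E (D i f) (sg x) = D i (E f) (sg x) - D i f (sg x).
    by rewrite (fr_der_euler fr oV VW i sf sg1) addrC addKr.
  rewrite eE /G mulr1.
  by move: (N x) (Nn0 Ux) (D i f (sg x)) (D i (D i f) (sg x)) (X i x) (E f (sg x))
     (D i (E f) (sg x)) (D i (fun z => E f (sg z)) x) => *; field.
rewrite [LHS](eq_bigr _ (fun i _ => step i)) -mulr_sumr.
transitivity ((N x)^-1 * ((N x)^-1 * L f (sg x) +
    (- (2 * (N x)^-1)) * (N x * E (E f) (sg x)) + (- (2 * E f (sg x))) * d +
    (- 2) * E (fun z => E f (sg z)) x + (4 * (N x)^-1 * E f (sg x)) * N x)).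
  congr (_ * _); rewrite !big_split; congr (_ + _ + _ + _ + _).
  - by rewrite -mulr_sumr.
  - by rewrite -mulr_sumr sum_sg.
  - by rewrite sumr_const mulr_natr.
  - by rewrite -mulr_sumr.
  - by rewrite -mulr_sumr (fr_sqnorm fr UW Ux).
rewrite (fr_euler_inversion sE Ux).
by move: (N x) (Nn0 Ux) (L f (sg x)) (E (E f) (sg x)) (E f (sg x)) d => *; field.
Qed.

Lemma fr_iter_lap_inversion k f x : smooth k.*2 V f -> U x ->
  iter k L (fun z => Num.sqrt (N z) ^ (k.*2%:Z - #|I|%:Z) * f (sg z)) x =
  Num.sqrt (N x) ^ (- k.*2%:Z - #|I|%:Z) * iter k L f (sg x).
Proof.
pose w (m : int) z := Num.sqrt (N z) ^ m.
have w0 z : U z -> Num.sqrt (N z) != 0 by move=> Uz; rewrite gt_eqF // sqrtr_gt0 N0.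
have sw j m : smooth j U (w m).
  by apply: (smooth_expz m oU w0); exact: smooth_sqrt.
have dw m i z : U z -> D i (w m) z = m%:~R * w m z * X i z / N z.
  move=> Uz.
  rewrite [LHS]derive_expz //; last first; first exact: w0.
    by apply: sqrt_differentiable; [exact: dN|exact: N0].
  rewrite derive_sqrt; [|exact: dN|exact: N0].
  rewrite [X in _ * (_ * X)](fr_der_sqnorm a i z) /w.
  have -> : Num.sqrt (N z) ^ (m - 1) = Num.sqrt (N z) ^ m / Num.sqrt (N z).
    by rewrite expfzDr ?w0 // exprN1.
  rewrite -[X in _ = _ / X](sqr_sqrtr (ltW (N0 Uz))).
  by move: (Num.sqrt (N z) ^ m) (Num.sqrt (N z)) (w0 _ Uz) (X i z) => *; field.
have wS m z : U z -> w (m + 2) z = N z * w m z.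
  by move=> Uz; rewrite /w expfzDr ?w0 // mulrC -[_ ^ 2]/(_ ^+ 2) sqr_sqrtr // ltW // N0.
elim: k f x => [|k IHk] f x sf Ux; first by [].
set m := k.*2%:Z - #|I|%:Z.
have sf' : smooth k.*2 V f by apply: smooth_le sf; rewrite leq_double.
pose g z := w m z * f (sg z).
have sgm : smooth k.+1.*2 U g.
  by apply: (smooth_mul oU (sw _ _)); exact: smooth_comp_inversion.
pose F := iter k L f; pose m' := - k.*2%:Z - #|I|%:Z.
have sF : smooth 2 V F.
  by apply: (smooth_iter_fr_lap fr oV VW); rewrite addn2 -doubleS.
have sF1 := smoothW sF.
have sFc := smooth_comp_inversion sF.
have eg z : U z -> iter k L g z = w m' z * F (sg z) by move=> Uz; exact: IHk.
(* Passing from [k] to [k.+1] raises the exponent by two, so exactly one factor [N] splits off and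
   the product formula for [N * g] applies. *)
have e1 z : U z -> w (k.+1.*2%:Z - #|I|%:Z) z * f (sg z) = N z * g z.
  move=> Uz; rewrite /g mulrA -wS //; congr (w _ _ * _).
  by rewrite /m doubleS -addn2 PoszD addrAC.
rewrite (fr_iter_lap_eq a oU k.+1 e1 Ux).
rewrite [LHS](fr_iter_lap_sqnorm_mul fr oU UW sgm Ux) .
rewrite (_ : iter k.+1 L g x = L (fun z => w m' z * F (sg z)) x); last first.
  by rewrite iterS; exact: (fr_lap_eq a oU eg Ux).
rewrite (fr_euler_eq a oU eg Ux) (eg _ Ux).
rewrite (fr_lap_weight fr oU UW (sw 2 m') (dw m') sFc Ux) .
rewrite (fr_euler_mul a) ; [|exact: smooth_differentiable (sw 1 m') Ux|exact: dcomp].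
have -> : E (w m') x = m'%:~R * w m' x.
  transitivity (m'%:~R * w m' x / N x * \sum_i X i x ^+ 2).
    rewrite mulr_sumr; apply: eq_bigr => i _; rewrite dw //.
    by move: (w m' x) (X i x) (N x)^-1 => *; ring.
  by rewrite (fr_sqnorm fr UW Ux) mulfVK // Nn0.
rewrite (fr_lap_inversion sF Ux) (fr_euler_inversion sF1 Ux).
have -> : Num.sqrt (N x) ^ (- k.+1.*2%:Z - #|I|%:Z) = w m' x / N x.
  apply: (mulIf (Nn0 Ux)); rewrite mulfVK ?Nn0 // mulrC -[Num.sqrt _ ^ _]/(w _ x) -wS //.
  by rewrite /m' doubleS -addn2 PoszD opprD addrAC subrK.
(* For this [m'] the coefficient of [F (sg x)] is [(2 k + d) (2 k + 2) (1 - 2 + 1) = 0]. That of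
   [E F (sg x)] is [(4 - 2 d) - (2 m' + 4 (k + 1)) = 0], so only [L F (sg x)] is left. *)
have -> : (m'%:~R : R) = - (2 * k%:R) - d.
  by rewrite /m' rmorphB rmorphN /= -muln2 PoszM rmorphM /= mulrC.
rewrite iterS -/F -[k.+1%:R]natr1.
move: (w m' x) (N x) (Nn0 Ux) (L F (sg x)) (E F (sg x)) (F (sg x)) => *.
by move: (k%:R : R) (d : R) => *; field.
Qed.

End Inversion.

(** * The slice frame *)

Lemma big_option (M : nmodType) (T : finType) (F : option T -> M) :
  \sum_i F i = F None + \sum_(i : T) F (Some i).
Proof.
rewrite (bigD1 None) //=; congr (_ + _).
by rewrite (reindex_omap Some id) => [|[i|]] //=; apply: eq_bigl => i; rewrite eqxx.
Qed.

(** * Maps carrying the frame to a constant multiple of itself *)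

Section Affine.
Variables (R : realType) (n : nat) (I : finType).
Variables (W : set 'rV[R]_n) (a : I -> 'rV[R]_n -> 'rV[R]_n).
Hypothesis fr : parallel_frame W a.
Variables (U V : set 'rV[R]_n) (phi : 'rV[R]_n -> 'rV[R]_n) (mu : R).
Hypotheses (oU : open U) (UW : U `<=` W) (oV : open V) (VW : V `<=` W).
Hypothesis UV : forall x, U x -> V (phi x).
Hypothesis sphi : forall k m, smooth k U (fun x => phi x 0 m).
Hypothesis dphi : forall i m x, U x ->
  fr_der a i (fun z => phi z 0 m) x = mu * a i (phi x) 0 m.
Local Notation D := (fr_der a).
Local Notation L := (fr_lap a).

Let dVx f x : smooth 1 V f -> U x -> differentiable f (phi x).
Proof. by move=> sf Ux; exact: smooth_differentiable sf (UV Ux). Qed.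

(** By [dphi] the differential of [phi] sends the frame vector at [x] to [mu] times the frame vector
    of the same index at [phi x]. As [mu] is constant, iteration creates no lower-order terms. *)
Lemma fr_der_affine i f x : smooth 1 V f -> U x ->
  D i (fun z => f (phi z)) x = mu * D i f (phi x).
Proof.
move=> sf Ux; rewrite [LHS]derive_chain; [|exact: dVx|]; last first.
  by move=> j; exact: smooth_differentiable (sphi 1 j) Ux.
rewrite (fr_der_partials a i (dVx sf Ux)) mulr_sumr; apply: eq_bigr => m _.
by rewrite [X in X * _]dphi // mulrA.
Qed.

Lemma fr_lap_affine f x : smooth 2 V f -> U x ->
  L (fun z => f (phi z)) x = mu ^+ 2 * L f (phi x).
Proof.
move=> sf Ux; have sf1 := smoothW sf.
rewrite mulr_sumr; apply: eq_bigr => i _.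
have sD := smooth_fr_der fr oV VW i sf.
have e z : U z -> D i (fun z => f (phi z)) z = mu * D i f (phi z).
  by move=> Uz; exact: fr_der_affine.
have sc := smooth_comp oU UV (sphi 1) sD.
rewrite (fr_der_eq a oU i e Ux) [LHS](derive_mulc _ _ (smooth_differentiable sc Ux)).
by rewrite [X in _ * X](fr_der_affine i sD Ux) mulrA.
Qed.

Lemma fr_iter_lap_affine k f x : smooth k.*2 V f -> U x ->
  iter k L (fun z => f (phi z)) x = mu ^+ k.*2 * iter k L f (phi x).
Proof.
elim: k x => [|k IHk] x sf Ux; first by rewrite mul1r.
have sf' : smooth k.*2 V f by apply: smooth_le sf; rewrite leq_double.
have sF : smooth 2 V (iter k L f).
  by apply: (smooth_iter_fr_lap fr oV VW); rewrite addn2 -doubleS.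
have e z : U z -> iter k L (fun z => f (phi z)) z = mu ^+ k.*2 * iter k L f (phi z).
  by move=> Uz; exact: IHk.
have sc := smooth_comp oU UV (sphi 2) sF.
rewrite !iterS (fr_lap_eq a oU e Ux) (fr_lap_mulc fr oU UW _ sc Ux).
by rewrite (fr_lap_affine sF Ux) doubleS !exprS; move: (mu ^+ _) => *; ring.
Qed.

End Affine.

Section SliceFrame.
Variables (R : realType) (p q : nat).
Implicit Types (x : 'rV[R]_(p + q)) (i : option 'I_p).

Definition slice_domain : set 'rV[R]_(p + q) := ~` @Rp_subset R p q.
Definition slice_radius x : R := Num.sqrt (\sum_(j < q) x 0 (rshift p j) ^+ 2).
(** [None] indexes the radial direction of [x_q]; the [p + 1] indices account for the [p + 1] in the
    weights. *)
Definition slice_frame i x : 'rV[R]_(p + q) :=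
  if i is Some j then delta_mx 0 (lshift q j)
  else (slice_radius x)^-1 *: row_mx 0 (rsubmx x).

Local Notation W := slice_domain.
Local Notation r := slice_radius.
Local Notation S := (fun x : 'rV[R]_(p + q) => \sum_(j < q) x 0 (rshift p j) ^+ 2).

Lemma slice_sqradius_gt0 x : W x -> 0 < S x.
Proof.
move=> Wx; rewrite lt_def sumr_ge0 ?andbT => [|m _]; last exact: sqr_ge0.
apply/eqP => S0; apply: Wx; apply/rowP => j; rewrite !mxE; apply/eqP.
rewrite -sqrf_eq0; apply/eqP.
by move: j isT; apply: psumr_eq0P S0 => m _; exact: sqr_ge0.
Qed.

Lemma slice_sqradius0 x : ~ W x -> S x = 0.
Proof.
move=> /contrapT Wx; rewrite big1 // => j _.
have /rowP/(_ j) : rsubmx x = 0 by exact: Wx.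
by rewrite !mxE => ->; rewrite expr0n.
Qed.

Lemma slice_domainE x : W x <-> 0 < S x.
Proof.
split; first exact: slice_sqradius_gt0.
by move=> S0; apply: contrapT => /slice_sqradius0 e; rewrite e ltxx in S0.
Qed.

Lemma smooth_slice_sqradius k U : open U -> smooth k U S.
Proof.
move=> oU; apply: smooth_sum => // m; under eq_fun do rewrite expr2.
by apply: smooth_mul => //; exact: smooth_coord.
Qed.

Lemma open_slice_domain : open W.
Proof.
have cS : continuous S.
  by move=> x; exact: (@smooth_continuous _ _ 0 setT _ _ (smooth_slice_sqradius 0 openT)).
have -> : W = S @^-1` [set y | 0 < y].
  by apply/seteqP; split=> x /= /slice_domainE.
by apply: open_comp => [x _|]; [exact: cS|exact: open_gt].
Qed.

Let oW := open_slice_domain.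

Lemma slice_radius_gt0 x : W x -> 0 < r x.
Proof. by move=> Wx; rewrite sqrtr_gt0 slice_sqradius_gt0. Qed.

Lemma sqr_slice_radius x : r x ^+ 2 = S x.
Proof. by rewrite sqr_sqrtr // sumr_ge0 // => j _; exact: sqr_ge0. Qed.

Lemma smooth_slice_radius k : smooth k W r.
Proof.
by apply: smooth_sqrt => //; [exact: slice_sqradius_gt0|exact: smooth_slice_sqradius].
Qed.

Lemma slice_frameL i x k : slice_frame i x 0 (lshift q k) = (i == Some k)%:R.
Proof.
case: i => [j|] /=; rewrite !mxE ?eqxx /=.
  by rewrite eq_lshift eq_sym.
by rewrite (unsplitK (inl k)) mxE mulr0.
Qed.

Lemma slice_frameR i x k :
  slice_frame i x 0 (rshift p k) = if i is None then (r x)^-1 * x 0 (rshift p k) else 0.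
Proof.
case: i => [j|] /=; rewrite !mxE ?eqxx /=; first by rewrite eq_rlshift.
by rewrite (unsplitK (inr k)) mxE.
Qed.

Lemma sum_slice_frame (F : 'I_(p + q) -> R) i x :
  \sum_m slice_frame i x 0 m * F m =
  if i is Some j then F (lshift q j)
  else (r x)^-1 * \sum_(k < q) x 0 (rshift p k) * F (rshift p k).
Proof.
rewrite big_split_ord /=; under eq_bigr do rewrite slice_frameL.
under [X in _ + X]eq_bigr do rewrite slice_frameR.
case: i => [j|].
  rewrite [X in _ + X]big1 ?addr0 => [|k _]; last by rewrite mul0r.
  rewrite (bigD1 j) //= eqxx mul1r big1 ?addr0 // => k kj.
  by rewrite (_ : (Some j == Some k) = false) ?mul0r //; apply/negbTE; rewrite eq_sym.
rewrite big1 ?add0r => [|k _]; last by rewrite mul0r.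
by rewrite mulr_sumr; apply: eq_bigr => k _; rewrite mulrA.
Qed.

Lemma slice_frame_orth x i j : W x ->
  \sum_m slice_frame i x 0 m * slice_frame j x 0 m = (i == j)%:R.
Proof.
move=> Wx; rewrite sum_slice_frame; case: i => [i|]; first by rewrite slice_frameL eq_sym.
under eq_bigr do rewrite slice_frameR.
case: j => [j|]; first by rewrite big1 ?mulr0 // => k _; rewrite mulr0.
under eq_bigr do rewrite mulrCA -expr2.
rewrite -mulr_sumr -sqr_slice_radius eqxx mulr1n.
by move: (r x) (slice_radius_gt0 Wx) => s s0; field; rewrite gt_eqF.
Qed.

Lemma slice_frame_span x m : W x ->
  x 0 m = \sum_i fr_coord slice_frame i x * slice_frame i x 0 m.
Proof.
move=> Wx; rewrite big_option.
have cS j : fr_coord slice_frame (Some j) x = x 0 (lshift q j).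
  rewrite /fr_coord; under eq_bigr do rewrite mulrC.
  by rewrite sum_slice_frame.
have cN : fr_coord slice_frame None x = r x.
  rewrite /fr_coord; under eq_bigr do rewrite mulrC.
  rewrite sum_slice_frame; under eq_bigr do rewrite -expr2.
  rewrite -sqr_slice_radius.
  by move: (r x) (slice_radius_gt0 Wx) => s s0; field; rewrite gt_eqF.
rewrite cN; under eq_bigr do rewrite cS.
case: (split_ordP m) => k ->.
  rewrite slice_frameL mulr0 add0r (bigD1 k) // slice_frameL eqxx mulr1n mulr1 big1 => [|j jk]; first by rewrite [RHS]addr0.
  by rewrite slice_frameL (_ : (Some j == Some k) = false) ?mulr0 //; exact/negbTE.
rewrite slice_frameR big1 ?addr0 => [|j _]; last by rewrite slice_frameR mulr0.
by rewrite mulrA mulfV ?mul1r // gt_eqF // slice_radius_gt0.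
Qed.

Lemma smooth_slice_frame k i m : smooth k W (fun x => slice_frame i x 0 m).
Proof.
case: (split_ordP m) => j ->.
  by under eq_fun do rewrite slice_frameL; exact: smooth_const.
under eq_fun do rewrite slice_frameR; case: i => [i|]; first exact: smooth_const.
apply: (smooth_mul oW); last exact: smooth_coord.
apply: smooth_inv => //; last exact: smooth_slice_radius.
by move=> x Wx; rewrite gt_eqF // slice_radius_gt0.
Qed.

Lemma slice_frame_derive_radius i x : W x ->
  'D_(slice_frame i x) r x = if i is None then 1 else 0.
Proof.
move=> Wx; have dS : differentiable S x.
  exact: smooth_differentiable (smooth_slice_sqradius 1 oW) Wx.
have S0 := slice_sqradius_gt0 Wx.
rewrite derive_sqrt // -/(r x) derive_bigsum; last first.
  by move=> j; under eq_fun do rewrite expr2; apply: diff_mul; exact: differentiable_coord.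
have e j : 'D_(slice_frame i x) (fun z : 'rV[R]_(p + q) => z 0 (rshift p j) ^+ 2) x =
    2 * (x 0 (rshift p j) * slice_frame i x 0 (rshift p j)).
  under eq_fun do rewrite expr2.
  rewrite derive_mul ?derive_coord; try exact: differentiable_coord.
  by move: (x 0 _) => *; ring.
under eq_bigr do rewrite e slice_frameR.
rewrite -mulr_sumr; case: i {e} => [i|].
  by rewrite big1 ?mulr0 // => k _; rewrite mulr0.
under eq_bigr do rewrite mulrCA -expr2.
rewrite -mulr_sumr -sqr_slice_radius.
by move: (r x) (slice_radius_gt0 Wx) => s s0; field; rewrite gt_eqF.
Qed.

(** Only the radial vector [x_q / |x_q|] varies. A move along [R^p] leaves [x_q] alone, and a move
    along [x_q] stretches it without turning it. *)
Lemma slice_frame_parallel x i j m : W x ->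
  fr_der slice_frame i (fun z => slice_frame j z 0 m) x = 0.
Proof.
move=> Wx; rewrite /fr_der; case: (split_ordP m) => k ->.
  by under eq_fun do rewrite slice_frameL; exact: derive_const.
under eq_fun do rewrite slice_frameR; case: j => [j|]; first exact: derive_const.
have r0 := slice_radius_gt0 Wx.
have dr : differentiable r x by exact: smooth_differentiable (smooth_slice_radius 1) Wx.
have rn0 : r x != 0 by rewrite gt_eqF.
rewrite derive_mul ?derive_coord; [|exact: differentiableV|exact: differentiable_coord].
rewrite (derive_inv _ dr rn0) slice_frame_derive_radius // slice_frameR.
case: i => [i|]; first by rewrite !mulr0 addr0.
by move: (r x) (x 0 _) rn0 => *; field.
Qed.

Lemma slice_frame_scale x (c : R) : W x -> 0 < c ->
  W (c *: x) /\ forall i, slice_frame i (c *: x) = slice_frame i x.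
Proof.
move=> Wx c0; have eS : S (c *: x) = c ^+ 2 * S x.
  by rewrite mulr_sumr; apply: eq_bigr => j _; rewrite !mxE exprMn.
have er : r (c *: x) = c * r x.
  by rewrite /slice_radius eS sqrtrM ?sqr_ge0 // sqrtr_sqr gtr0_norm.
split; first by apply/slice_domainE; rewrite eS mulr_gt0 ?exprn_gt0 // slice_sqradius_gt0.
move=> i; apply/rowP => m; case: (split_ordP m) => k ->; first by rewrite !slice_frameL.
rewrite !slice_frameR; case: i => [//|]; rewrite er mxE invfM.
by rewrite mulrACA mulVf ?mul1r // gt_eqF.
Qed.

Lemma slice_parallel_frame : parallel_frame W slice_frame.
Proof.
split.
- exact: open_slice_domain.
- by move=> x Wx; apply/eqP => x0; apply: Wx; rewrite x0 /Rp_subset /= linear0.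
- exact: smooth_slice_frame.
- by move=> x i j; exact: slice_frame_orth.
- by move=> x i j m; exact: slice_frame_parallel.
- by move=> x m; exact: slice_frame_span.
- by move=> x c; exact: slice_frame_scale.
Qed.

End SliceFrame.

Lemma open_preimage_on (S T : topologicalType) (W : set S) (V : set T) (phi : S -> T) :
  open W -> open V -> (forall x, W x -> {for x, continuous phi}) ->
  open [set x | W x /\ V (phi x)].
Proof.
move=> oW oV cphi; rewrite openE => x [Wx Vx].
apply: filterI; first exact: open_nbhs_nbhs.
by apply: (cphi x Wx V); exact: open_nbhs_nbhs.
Qed.

(** * Covariant maps and their composition *)

Section Covariance.
Variables (R : realType) (p q : nat).
Implicit Types (x : 'rV[R]_(p + q)) (phi : 'rV[R]_(p + q) -> 'rV[R]_(p + q))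
  (nu : 'rV[R]_(p + q) -> R).
Local Notation W := (@slice_domain R p q).
Local Notation r := (@slice_radius R p q).
Local Notation L := (fr_lap (@slice_frame R p q)).
Local Notation D := (fr_der (@slice_frame R p q)).
Local Notation S := (fun x : 'rV[R]_(p + q) => \sum_(j < q) x 0 (rshift p j) ^+ 2).
Let fr := @slice_parallel_frame R p q.
Let oW := @open_slice_domain R p q.

Definition covariance_weight (k : nat) : int := - p%:Z - 1 + k.*2%:Z.

(** [nu] stands for [|c x + d|]. Openness of [U] and smoothness of [g] belong to the conclusion so
    that [g] can be fed to the next covariant map; [U] is cut down to the complement of [R^p]
    because [phi] is a total function, controlled only there. *)
Definition lap_covariant phi nu := forall k (V : set 'rV[R]_(p + q)) f,
  open V -> V `<=` W -> smooth k.*2 V f ->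
  let U := [set x | W x /\ V (phi x)] in
  let g := fun z => nu z ^ covariance_weight k * f (phi z) in
  [/\ open U, smooth k.*2 U g & forall x, U x ->
    iter k L f (phi x) = nu x ^+ (p + 1 + k.*2) * iter k L g x].

(** The second map is applied to the weighted function produced by the first. Integer powers being
    multiplicative, the two weights merge into the power of the cocycle [nu1 (phi2 x) * nu2 x]. *)
Lemma lap_covariant_comp phi1 nu1 phi2 nu2 :
  (forall x, W x -> W (phi2 x)) ->
  lap_covariant phi1 nu1 -> lap_covariant phi2 nu2 ->
  lap_covariant (fun x => phi1 (phi2 x)) (fun x => nu1 (phi2 x) * nu2 x).
Proof.
move=> W2 c1 c2 k V f oV VW sf U g.
have [oU1 sg1 e1] := c1 k V f oV VW sf.
have [|oU2 sg2 e2] := c2 k _ _ oU1 _ sg1; first by move=> x [].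
have UE : [set x | W x /\ (W (phi2 x) /\ V (phi1 (phi2 x)))] = U.
  by apply/seteqP; split=> x /= [Wx]; [case|split=> //; split=> //; exact: W2].
rewrite UE in oU2 sg2 e2.
have gE : g = fun z => nu2 z ^ covariance_weight k *
    (nu1 (phi2 z) ^ covariance_weight k * f (phi1 (phi2 z))).
  by apply/funext => z; rewrite /g expfzMl mulrAC mulrC.
rewrite gE; split=> // x Ux; have [Wx Vx] := Ux.
rewrite e1; last by split=> //; exact: W2.
by rewrite e2 // exprMn mulrA.
Qed.

(** The factor [c ^- 2] is the conformal factor [|c x + d|^(-2)] of a Möbius map in the case of a
    constant denominator. *)
Lemma lap_covariant_affine phi (c : R) : 0 < c ->
  (forall k m, smooth k W (fun x => phi x 0 m)) ->
  (forall i m x, W x ->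
     D i (fun z => phi z 0 m) x = c ^- 2 * slice_frame i (phi x) 0 m) ->
  lap_covariant phi (fun=> c).
Proof.
move=> c0 sphi dphi k V f oV VW sf U g.
have oU : open U.
  apply: open_preimage_on => // x Wx; apply: continuous_rV => j.
  exact: smooth_continuous (sphi 0 j) Wx.
have UW : U `<=` W by move=> x [].
have UV x : U x -> V (phi x) by case.
have sphiU j m : smooth j U (fun x => phi x 0 m) := smooth_sub UW (sphi j m).
have dphiU i m x : U x -> D i (fun z => phi z 0 m) x = c ^- 2 * slice_frame i (phi x) 0 m.
  by move=> /UW; exact: dphi.
have sc := smooth_comp oU UV (sphiU k.*2) sf.
split=> // [|x Ux]; first exact: (smooth_mul oU (smooth_const _ _ _) sc).
pose s := c ^ covariance_weight k.
(* The bound [j <= k] keeps the order of differentiation within the [2 k] derivatives available. *)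
have eg j z : (j <= k)%N -> U z -> iter j L g z = s * iter j L (fun z => f (phi z)) z.
  elim: j z => [//|j IHj] z jk Uz; rewrite !iterS.
  have e z1 : U z1 -> iter j L g z1 = s * iter j L (fun z => f (phi z)) z1.
    by apply: IHj; exact: ltnW.
  rewrite (fr_lap_eq _ oU e Uz); apply: (fr_lap_mulc fr oU UW) => //.
  apply: (smooth_iter_fr_lap fr oU UW); apply: smooth_le sc.
  by rewrite addn2 -doubleS leq_double.
rewrite eg // (fr_iter_lap_affine fr oU UW oV VW UV sphiU dphiU sf Ux) mulrA mulrA.
rewrite (_ : _ * s * _ = 1) ?mul1r //.
have cn0 : c != 0 by rewrite gt_eqF.
(* The exponents of [c] add up to [(p + 1 + 2 k) + (- p - 1 + 2 k) - 4 k = 0]. *)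
rewrite exprVn -exprM exprnN exprnP -!expfzDr // (_ : _ + _ = 0) //.
rewrite PoszM !PoszD /covariance_weight; ring.
Qed.

Lemma lap_covariant_inversion :
  lap_covariant (@rv_inversion R _) (fun x => Num.sqrt (rv_sqnorm x)).
Proof.
move=> k V f oV VW sf U g.
have UW : U `<=` W by move=> x [].
have N0 : forall x, W x -> 0 < rv_sqnorm x := fr_sqnorm_gt0 fr (@subset_refl _ W).
have Nn0 x : W x -> rv_sqnorm x != 0 by move=> Wx; rewrite gt_eqF // N0.
have sphi j m : smooth j W (fun x => rv_inversion x 0 m).
  rewrite (_ : (fun _ => _) = fun z => (rv_sqnorm z)^-1 * z 0 m); last first.
    by apply/funext => z; rewrite mxE.
  apply: (smooth_mul oW); last exact: smooth_coord.
  exact: (smooth_inv oW Nn0 (smooth_sqnorm oW j)).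
have oU : open U.
  apply: (open_preimage_on oW oV) => x Wx; apply: (@continuous_rV R _ _ (@rv_inversion R (p + q))) => j.
  exact: (@smooth_continuous R _ 0 W (fun x => rv_inversion x 0 j) x (sphi 0%N j) Wx).
have UV x : U x -> V (rv_inversion x) by case.
have s0 x : U x -> 0 < Num.sqrt (rv_sqnorm x) by move=> /UW Ux; rewrite sqrtr_gt0 N0.
have w0 x : U x -> Num.sqrt (rv_sqnorm x) != 0 by move=> Ux; rewrite gt_eqF // s0.
have sphiU j m := smooth_sub UW (sphi j m).
split=> // [|x Ux].
  apply: (smooth_mul oU); last exact: (smooth_comp oU UV (sphiU _) sf).
  have sN := smooth_sqrt oU (fun x Ux => N0 x (UW x Ux)) (smooth_sqnorm oU k.*2).
  exact: (smooth_expz _ oU w0 sN).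
have := fr_iter_lap_inversion fr oU UW oV VW UV sf Ux.
rewrite card_option card_ord.
have -> : k.*2%:Z - p.+1%:Z = covariance_weight k.
  by rewrite /covariance_weight -addn1 PoszD opprD addrC.
move=> ->; rewrite mulrA -[_ ^+ _]/(_ ^ (p + 1 + k.*2)%:Z) -expfzDr ?w0 //.
by rewrite (_ : _ + _ = 0) ?mul1r // -addn1 !PoszD; ring.
Qed.

End Covariance.

(** * Covariance of translations, dilations and reflections *)

Section Maps.
Variables (R : realType) (p q : nat).
Implicit Types (x : 'rV[R]_(p + q)).
Local Notation W := (@slice_domain R p q).
Local Notation S := (fun x : 'rV[R]_(p + q) => \sum_(j < q) x 0 (rshift p j) ^+ 2).
Local Notation D := (fr_der (@slice_frame R p q)).
Let oW := @open_slice_domain R p q.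

Definition slice_translation (b : 'rV[R]_p) x := x + row_mx b 0.
(** For a unit vector [a] of [R^q], this is the orthogonal reflection in the hyperplane
    perpendicular to [a]. *)
Definition slice_reflection (a : 'rV[R]_q) x :=
  x - (2 * \sum_j x 0 (rshift p j) * a 0 j) *: row_mx 0 a.

Lemma slice_reflectionE a x m : slice_reflection a x 0 m =
  x 0 m - 2 * (\sum_j x 0 (rshift p j) * a 0 j) * row_mx (0 : 'rV[R]_p) a 0 m.
Proof. by rewrite /slice_reflection; move: (row_mx _ _) => w; rewrite !mxE. Qed.

Lemma sqradius_translation b x : S (slice_translation b x) = S x.
Proof. by apply: eq_bigr => j _; rewrite mxE row_mxEr mxE addr0. Qed.

Lemma sqradius_reflection (a : 'rV[R]_q) x : \sum_j a 0 j ^+ 2 = 1 -> S (slice_reflection a x) = S x.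
Proof.
move=> a1; have [t te] : {t | t = \sum_j x 0 (rshift p j) * a 0 j} by eexists.
transitivity (S x + - (4 * t) * (\sum_j x 0 (rshift p j) * a 0 j) + 4 * t ^+ 2 * \sum_j a 0 j ^+ 2).
  rewrite !mulr_sumr -!big_split; apply: eq_bigr => j _.
  rewrite /= slice_reflectionE row_mxEr -te.
  by move: (x 0 _) (a 0 _) => *; ring.
by rewrite a1 -te; move: (S x) => *; ring.
Qed.

Lemma covariant_translation b : lap_covariant (slice_translation b) (fun=> 1).
Proof.
have E m : (fun x => slice_translation b x 0 m) = (fun x => x 0 m + row_mx b 0 0 m).
  by apply/funext => x; rewrite mxE.
apply: lap_covariant_affine => // [k m|i m x Wx].
  by rewrite E; apply: (smooth_add oW); [exact: smooth_coord|exact: smooth_const].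
rewrite E [LHS]derive_add; [|exact: differentiable_coord|exact: diff_const].
rewrite derive_coord derive_const addr0 expr1n invr1 mul1r.
case: (split_ordP m) => j ->; rewrite ?slice_frameL // !slice_frameR.
by rewrite /slice_radius sqradius_translation mxE row_mxEr mxE addr0.
Qed.

(** The diagonal matrix with entries [c] and [c^-1] acts by [c ^+ 2] and has denominator [c^-1]. *)
Lemma covariant_dilation (c : R) : c != 0 ->
  lap_covariant (fun x => c ^+ 2 *: x) (fun=> `|c^-1|).
Proof.
move=> c0; apply: lap_covariant_affine => [|k m|i m x Wx].
- by rewrite normr_gt0 invr_eq0.
- under eq_fun do rewrite mxE.
  by apply: (smooth_mul oW); [exact: smooth_const|exact: smooth_coord].
under eq_fun do rewrite mxE.
rewrite [LHS]derive_mulc; last exact: differentiable_coord.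
rewrite derive_coord (slice_frame_scale Wx _).2; last by rewrite exprn_even_gt0.
by rewrite real_normK ?num_real // exprVn invrK.
Qed.

(** The map is linear, fixes the directions of [R^p] and preserves [|x_q|], so it takes the radial
    unit vector at [x] to the one at the image. *)
Lemma covariant_reflection (a : 'rV[R]_q) : \sum_j a 0 j ^+ 2 = 1 ->
  lap_covariant (slice_reflection a) (fun=> 1).
Proof.
move=> a1; pose t x := \sum_j x 0 (rshift p j) * a 0 j.
have E m : (fun x => slice_reflection a x 0 m) = (fun x => x 0 m + (-2 * row_mx 0 a 0 m) * t x).
  apply/funext => x; rewrite slice_reflectionE -/(t x).
  by move: (row_mx _ _ 0 m) (t x) (x 0 m) => *; ring.
have st k : smooth k W t.
  apply: (smooth_sum _ oW) => j; apply: (smooth_mul oW); last exact: smooth_const.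
  exact: smooth_coord.
apply: lap_covariant_affine => // [k m|i m x Wx].
  rewrite E; apply: (smooth_add oW); first exact: smooth_coord.
  by apply: (smooth_mul oW); [exact: smooth_const|exact: st].
have dt : differentiable t x by exact: smooth_differentiable (st 1) Wx.
rewrite E [LHS]derive_add; [|exact: differentiable_coord|]; last first.
  by apply: diff_mul => //; exact: diff_const.
rewrite derive_coord derive_mulc // expr1n invr1 mul1r.
have -> : 'D_(slice_frame i x) t x = if i is None then (slice_radius x)^-1 * t x else 0.
  rewrite derive_bigsum; last first.
    by move=> j; apply: diff_mul; [exact: differentiable_coord|exact: diff_const].
  have e j : 'D_(slice_frame i x) (fun z : 'rV[R]_(p + q) => z 0 (rshift p j) * a 0 j) x =
      a 0 j * slice_frame i x 0 (rshift p j).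
    rewrite derive_mul; [|exact: differentiable_coord|exact: diff_const].
    by rewrite derive_const derive_coord mulr0 add0r.
  under eq_bigr do rewrite e slice_frameR.
  case: i {e} => [i|]; first by rewrite big1 // => j _; rewrite mulr0.
  by rewrite /t mulr_sumr; apply: eq_bigr => j _; rewrite mulrCA [a 0 j * _]mulrC.
case: (split_ordP m) => j ->.
  by rewrite !slice_frameL row_mxEl mxE mulr0 mul0r addr0.
rewrite !slice_frameR row_mxEr; case: i => [i|]; first by rewrite mulr0 addr0.
rewrite /slice_radius sqradius_reflection // slice_reflectionE row_mxEr -/(t x).
by move: (Num.sqrt _)^-1 (t x) (x 0 _) (a 0 _) => *; ring.
Qed.

End Maps.

(** * Vectors of the Clifford algebra and the square of the slice Dirac operator *)

Section CliffordVectors.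
Variables (R : realType) (n : nat).
Implicit Types (u v w : 'rV[R]_n) (a b c : clifford R n) (A B C : {set 'I_n}).
Local Notation e_ := (@cl_e R n).

Lemma cl_vec_linear : linear (@cl_vec R n).
Proof.
move=> k u v; rewrite scaler_sumr -big_split; apply: eq_bigr => i _.
by rewrite !mxE scalerDl scalerA.
Qed.

Lemma cl_vecD u v : cl_vec (u + v) = cl_vec u + cl_vec v.
Proof. by have := cl_vec_linear 1 u v; rewrite !scale1r. Qed.

Lemma cl_vec0 : cl_vec (0 : 'rV[R]_n) = 0.
Proof. by rewrite /cl_vec big1 // => i _; rewrite mxE scale0r. Qed.

Lemma cl_vecZ k u : cl_vec (k *: u) = k *: cl_vec u.
Proof. by have := cl_vec_linear k u 0; rewrite addr0 cl_vec0 addr0. Qed.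

Lemma cl_vecN u : cl_vec (- u) = - cl_vec u.
Proof. by rewrite -scaleN1r cl_vecZ scaleN1r. Qed.

Lemma cl_vec_delta i : cl_vec (delta_mx 0 i) = e_ i.
Proof.
rewrite /cl_vec (bigD1 i) //= mxE !eqxx scale1r big1 ?addr0 // => j ji.
by rewrite mxE (negPf ji) andbF scale0r.
Qed.

Lemma cl_vec_anticomm u v :
  cl_vec u * cl_vec v + cl_vec v * cl_vec u = - (2 * \sum_m u 0 m * v 0 m) *: 1.
Proof.
have e (s t : 'rV[R]_n) : cl_vec s * cl_vec t =
    \sum_i \sum_j (s 0 i * t 0 j) *: (e_ i * e_ j).
  rewrite mulr_suml; apply: eq_bigr => i _; rewrite mulr_sumr; apply: eq_bigr => j _.
  by rewrite -scalerAl -scalerAr scalerA.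
rewrite e (e v u) [X in _ + X]exchange_big -big_split mulr_sumr -sumrN scaler_suml.
apply: eq_bigr => i _; rewrite -big_split (bigD1 i) //= big1 => [|j ji].
  by rewrite addr0 (mulrC (v 0 i)) -scalerDr cl_e_anticomm eqxx mulr1 scalerA mulrN mulrC.
rewrite (mulrC (v 0 j)) -scalerDr cl_e_anticomm eq_sym (negPf ji) mulr0 oppr0 scale0r.
by rewrite scaler0.
Qed.

Lemma cl_vec_sqr u : cl_vec u * cl_vec u = - rv_sqnorm u *: 1.
Proof.
have n2 : (2 : R) != 0 by rewrite pnatr_eq0.
apply: (scalerI n2); rewrite scalerA mulrN scaler_nat mulr2n cl_vec_anticomm.
by congr (- (2 * _) *: _); apply: eq_bigr => i _; rewrite expr2.
Qed.

Lemma clifford_symdK A : involutive (symd A).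
Proof.
by move=> B; apply/setP => x; rewrite !inE; case: (x \in A); case: (x \in B).
Qed.

Lemma cl_e_mulE i a C : (e_ i * a) C =
  cl_sign R [set i]%SET (symd [set i]%SET C) * a (symd [set i]%SET C).
Proof.
rewrite ffunE (bigD1 [set i]%SET) //= big1 ?addr0 => [|B nB]; first by rewrite ffunE eqxx mulr1.
by rewrite ffunE (negPf nB) mulr0 mul0r.
Qed.

Lemma cl_e_sqr i : e_ i * e_ i = -1.
Proof.
rewrite -cl_vec_delta cl_vec_sqr /rv_sqnorm (bigD1 i) //= big1 => [|j ji].
  by rewrite mxE !eqxx expr1n addr0 scaleN1r.
by rewrite mxE (negPf ji) andbF expr0n.
Qed.

Lemma cl_sign_sqr i C : cl_sign R [set i]%SET C * cl_sign R [set i]%SET C = 1.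
Proof.
rewrite /cl_sign !big_set1 -big_split big1 // => j _.
by rewrite /=; case: ifP => _; rewrite ?mulrNN mulr1.
Qed.

(** The coordinate at [C] of [e_i * (e_i * e_C) = - e_C] says that the two signs have product
    [-1]. *)
Lemma cl_sign_toggle i C :
  cl_sign R [set i]%SET (symd [set i]%SET C) = - cl_sign R [set i]%SET C.
Proof.
have := congr1 (fun a : clifford R n => (a * cl_blade R C) C) (cl_e_sqr i).
rewrite -mulrA !cl_e_mulE clifford_symdK ffunE eqxx mulr1 mulN1r !ffunE eqxx => e.
by rewrite -[LHS]mulr1 -(cl_sign_sqr i C) mulrA e mulN1r.
Qed.

Definition cl_dot a b : R := \sum_A a A * b A.

Lemma cl_normE a : cl_norm a = Num.sqrt (cl_dot a a).
Proof. by []. Qed.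

(** Left multiplication by [e_i] permutes the blades up to sign by the involution [symd [set i]].
    The signs in the two directions are opposite, so it is skew-adjoint. *)
Lemma cl_dot_e i a b : cl_dot (e_ i * a) b = - cl_dot a (e_ i * b).
Proof.
rewrite /cl_dot [LHS](reindex_inj (can_inj (clifford_symdK [set i]%SET))) -sumrN.
apply: eq_bigr => C _; rewrite !cl_e_mulE clifford_symdK cl_sign_toggle.
by move: (a C) (b _) (cl_sign _ _ _) => *; ring.
Qed.

Lemma cl_dot_vec u a b : cl_dot (cl_vec u * a) b = - cl_dot a (cl_vec u * b).
Proof.
have el (s t : clifford R n) : cl_dot (cl_vec u * s) t = \sum_i u 0 i * cl_dot (e_ i * s) t.
  under [RHS]eq_bigr do rewrite mulr_sumr.
  rewrite exchange_big; apply: eq_bigr => A _; rewrite mulr_suml sum_ffunE mulr_suml.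
  by apply: eq_bigr => i _; rewrite -scalerAl ffunE -mulrA.
have dotC (s t : clifford R n) : cl_dot s t = cl_dot t s.
  by apply: eq_bigr => A _; rewrite mulrC.
rewrite el dotC el -sumrN; apply: eq_bigr => i _.
by rewrite cl_dot_e dotC mulrN.
Qed.

(** Left multiplication by a vector is skew-adjoint with square [- |u|^2], hence [|u|] times an
    isometry. This lets the norm of the denominator be followed through a product of generators. *)
Lemma cl_norm_vec_mul u a :
  cl_norm (cl_vec u * a) = Num.sqrt (rv_sqnorm u) * cl_norm a.
Proof.
rewrite !cl_normE -sqrtrM; last by apply: sumr_ge0 => i _; exact: sqr_ge0.
rewrite cl_dot_vec mulrA cl_vec_sqr; congr Num.sqrt.
rewrite -scalerAl mul1r /cl_dot mulr_sumr -sumrN; apply: eq_bigr => A _.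
by rewrite ffunE /GRing.scale /=; move: (a A) => *; ring.
Qed.

Lemma cl_norm_scale k a : cl_norm (k *: a) = `|k| * cl_norm a.
Proof.
rewrite /cl_norm -sqrtr_sqr -sqrtrM ?sqr_ge0 //; congr Num.sqrt.
by rewrite mulr_sumr; apply: eq_bigr => A _; rewrite ffunE exprMn.
Qed.

Lemma cl_norm1 : cl_norm (1 : clifford R n) = 1.
Proof.
rewrite /cl_norm (bigD1 finset.set0) //= big1 => [|A nA].
  by rewrite ffunE eqxx expr1n addr0 sqrtr1.
by rewrite ffunE (negPf nA) expr0n.
Qed.

Lemma cl_norm_vec u : cl_norm (cl_vec u) = Num.sqrt (rv_sqnorm u).
Proof. by rewrite -[cl_vec u]mulr1 cl_norm_vec_mul cl_norm1 mulr1. Qed.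

Lemma cl_vec_unit u : u != 0 -> cl_vec u \is a GRing.unit.
Proof.
move=> /sqnorm_gt0 N0; have Nn0 : rv_sqnorm u != 0 by rewrite gt_eqF.
apply/unitrP; exists (- (rv_sqnorm u)^-1 *: cl_vec u).
by rewrite -scalerAl -scalerAr cl_vec_sqr scalerA mulrNN mulVf // scale1r.
Qed.

Lemma cl_vec_coordE u A : cl_vec u A = \sum_m u 0 m * e_ m A.
Proof. by rewrite sum_ffunE; apply: eq_bigr => m _; rewrite ffunE. Qed.

End CliffordVectors.

(** * The slice Dirac operator in the frame, and its even powers *)

Section SliceDirac.
Variables (R : realType) (p q : nat).
Local Notation Cl := (clifford R (p + q)).
Implicit Types (x : 'rV[R]_(p + q)) (f g : 'rV[R]_(p + q) -> Cl) (U : set 'rV[R]_(p + q)).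
Local Notation W := (@slice_domain R p q).
Local Notation r := (@slice_radius R p q).
Local Notation fa := (@slice_frame R p q).
Local Notation L := (fr_lap fa).
Local Notation D := (fr_der fa).
Local Notation G := (@slice_dirac R p q).
Let fr := @slice_parallel_frame R p q.
Let oW := @open_slice_domain R p q.

Definition cl_smooth k U f := forall A, smooth k U (fun z => f z A).

Definition cl_fr_der i f x : Cl := [ffun A => D i (fun z => f z A) x].
Local Notation cD := cl_fr_der.

(** The factor [1 / |x_q|^2] is shared out evenly: one [1 / |x_q|] normalizes the Clifford vector,
    the other the direction of differentiation. *)
Lemma slice_dirac_frame f x : W x -> (forall A, differentiable (fun z => f z A) x) ->
  G f x = \sum_i cl_vec (fa i x) * cD i f x.
Proof.
move=> Wx df; rewrite big_option addrC; congr (_ + _).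
  by apply: eq_bigr => i _; rewrite cl_vec_delta.
rewrite cl_vecZ cl_norm_vec sqr_sqrtr; last by apply: sumr_ge0 => j _; exact: sqr_ge0.
have -> : rv_sqnorm (row_mx 0 (rsubmx x) : 'rV[R]_(p + q)) = r x ^+ 2.
  rewrite sqr_slice_radius /rv_sqnorm big_split_ord /= big1 ?add0r => [|j _].
    by apply: eq_bigr => j _; rewrite row_mxEr mxE.
  by rewrite row_mxEl mxE expr0n.
have -> : cD None f x = (r x)^-1 *: \sum_(j < q) x 0 (rshift p j) *: cl_partial (rshift p j) f x.
  apply/ffunP => A; rewrite !ffunE sum_ffunE [LHS]derive_partials // sum_slice_frame.
  by congr (_ * _); apply: eq_bigr => j _; rewrite !ffunE.
by rewrite -!scalerAl -scalerAr scalerA -invfM -expr2.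
Qed.

Lemma slice_dirac_eq U f g x : open U -> U x -> (forall z, U z -> f z = g z) -> G f x = G g x.
Proof.
move=> oU Ux fg.
have e i : cl_partial i f x = cl_partial i g x.
  apply/ffunP => A; rewrite !ffunE; apply: (derive_eq_on _ oU Ux) => z Uz.
  by rewrite fg.
congr (_ + _ * _); first by apply: eq_bigr => i _; rewrite e.
by apply: eq_bigr => i _; rewrite e.
Qed.

Lemma iter_slice_dirac_eq U k f g x : open U -> U x -> (forall z, U z -> f z = g z) ->
  iter k G f x = iter k G g x.
Proof.
move=> oU Ux fg; elim: k x Ux => [|k IHk] x Ux; first exact: fg.
by rewrite !iterS; exact: slice_dirac_eq oU Ux IHk.
Qed.

Lemma slice_dirac_sqr U f x : open U -> U `<=` W -> cl_smooth 2 U f -> U x ->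
  G (G f) x = [ffun A => - L (fun z => f z A) x].
Proof.
move=> oU UW sf Ux.
have df A z : U z -> differentiable (fun z => f z A) z.
  by move=> Uz; exact: smooth_differentiable (sf A) Uz.
pose H z := \sum_i cl_vec (fa i z) * cD i f z.
have GH z : U z -> G f z = H z.
  by move=> Uz; apply: slice_dirac_frame => [|A]; [exact: UW|exact: df].
have sfa k i m : smooth k U (fun z => fa i z 0 m) := smooth_sub UW (@smooth_slice_frame R p q k i m).
have sv k i A : smooth k U (fun z => cl_vec (fa i z) A).
  under eq_fun do rewrite cl_vec_coordE.
  by apply: (smooth_sum _ oU) => m; apply: (smooth_mul oU) => //; exact: smooth_const.
(* The frame vectors are also constant as Clifford elements, so the Leibniz rule leaves only second
   derivatives of [f]. *)
have dv i j A : D i (fun z => cl_vec (fa j z) A) x = 0.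
  under eq_fun do rewrite cl_vec_coordE.
  have dfa m : differentiable (fun z => fa j z 0 m) x := smooth_differentiable (sfa 1 j m) Ux.
  rewrite [LHS]derive_bigsum => [|m]; last by apply: diff_mul => //; exact: diff_const.
  rewrite big1 // => m _; have dc := diff_const (cl_e R m A) x.
  rewrite (derive_mul _ (dfa m) dc) derive_const mulr0 add0r.
  by rewrite [X in _ * X](slice_frame_parallel i j m (UW _ Ux)) mulr0.
have sDf i A : smooth 1 U (fun z => cD i f z A).
  under eq_fun do rewrite ffunE.
  exact: (smooth_fr_der fr oU UW i (sf A)).
have HE A : (fun z => H z A) = fun z => \sum_j \sum_B
    cl_vec (fa j z) B * (cl_sign R B (symd B A) * cD j f z (symd B A)).
  apply/funext => z; rewrite sum_ffunE; apply: eq_bigr => j _.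
  by rewrite ffunE; apply: eq_bigr => B _; rewrite mulrCA mulrA.
have dvx j B : differentiable (fun z => cl_vec (fa j z) B) x := smooth_differentiable (sv 1 j B) Ux.
have dDx j B : differentiable (fun z => cD j f z B) x := smooth_differentiable (sDf j B) Ux.
have dsD c j B : differentiable (fun z => c * cD j f z B : R) x.
  by apply: diff_mul => //; exact: diff_const.
have dvD c j A B : differentiable (fun z => cl_vec (fa j z) B * (c * cD j f z A)) x.
  exact: diff_mul.
have dH A : differentiable (fun z => H z A) x.
  by rewrite HE; apply: diff_sum => j; apply: diff_sum => B.
have cDH i : cD i H x = \sum_j cl_vec (fa j x) * cD i (cD j f) x.
  apply/ffunP => A; rewrite ffunE HE sum_ffunE.
  rewrite [LHS]derive_bigsum => [|j]; last by apply: diff_sum => B.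
  apply: eq_bigr => j _; rewrite [RHS]ffunE derive_bigsum => [|B]; last exact: dvD.
  apply: eq_bigr => B _; rewrite derive_mul // derive_mulc //.
  by rewrite [X in _ + _ * X](dv i j B) mulr0 addr0 !ffunE mulrCA mulrA.
rewrite (slice_dirac_eq oU Ux GH) (slice_dirac_frame (UW _ Ux) dH).
under eq_bigr do rewrite cDH mulr_sumr.
have cDD i j A : cD i (cD j f) x A = D i (D j (fun z => f z A)) x.
  rewrite ffunE (_ : (fun z => cD j f z A) = D j (fun z => f z A)) //.
  by apply/funext => z; rewrite ffunE.
pose h i j := cD i (cD j f) x.
have hC i j : h i j = h j i.
  apply/ffunP => A; rewrite [LHS]cDD [RHS]cDD.
  exact: (fr_derC fr oU UW i j (sf A) Ux).
(* [T] is added to itself with the indices exchanged. Since [h] is symmetric, the products of frame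
   vectors combine into anticommutators, which vanish off the diagonal and equal [-2] on it. *)
set T := LHS; have TE : T = \sum_i \sum_j cl_vec (fa i x) * cl_vec (fa j x) * h i j.
  by apply: eq_bigr => i _; apply: eq_bigr => j _; rewrite mulrA.
have TC : T = \sum_i \sum_j cl_vec (fa j x) * cl_vec (fa i x) * h i j.
  by rewrite TE exchange_big; apply: eq_bigr => i _; apply: eq_bigr => j _; rewrite hC.
have n2 : (2 : R) != 0 by rewrite pnatr_eq0.
apply: (scalerI n2); rewrite scaler_nat mulr2n {1}TE TC -big_split /=.
transitivity (\sum_i (- 2) *: h i i).
  apply: eq_bigr => i _; rewrite -big_split (bigD1 i) //= big1 => [|j ji].
    rewrite -mulrDl cl_vec_anticomm (slice_frame_orth _ _ (UW _ Ux)) eqxx mulr1.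
    by rewrite -scalerAl mul1r addr0.
  rewrite -mulrDl cl_vec_anticomm (slice_frame_orth _ _ (UW _ Ux)) eq_sym (negPf ji).
  by rewrite mulr0 oppr0 scale0r mul0r.
apply/ffunP => A; rewrite sum_ffunE !ffunE [RHS]mulrN -mulNr mulr_sumr; apply: eq_bigr => i _.
by rewrite ffunE; congr (_ * _); exact: cDD.
Qed.

Lemma iter_slice_dirac_even U k f x : open U -> U `<=` W -> cl_smooth k.*2 U f -> U x ->
  iter k.*2 G f x = [ffun A => (-1) ^+ k * iter k L (fun z => f z A) x].
Proof.
move=> oU UW; elim: k x => [|k IHk] x sf Ux.
  by apply/ffunP => A; rewrite ffunE mul1r.
have sf' : cl_smooth k.*2 U f by move=> A; apply: smooth_le (sf A); rewrite leq_double.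
pose h z : Cl := [ffun A => (-1) ^+ k * iter k L (fun z => f z A) z].
have sLf A : smooth 2 U (iter k L (fun z => f z A)).
  by apply: (smooth_iter_fr_lap fr oU UW); rewrite addn2 -doubleS.
have sh : cl_smooth 2 U h.
  move=> A; under eq_fun do rewrite ffunE.
  exact: (smooth_mul oU (smooth_const _ _ _) (sLf A)).
have e z : U z -> iter k.*2 G f z = h z by move=> Uz; exact: IHk.
have e1 z : U z -> G (iter k.*2 G f) z = G h z.
  by move=> Uz; exact: slice_dirac_eq oU Uz e.
rewrite doubleS !iterS (slice_dirac_eq oU Ux e1) (slice_dirac_sqr oU UW sh Ux).
apply/ffunP => A; rewrite !ffunE.
under eq_fun do rewrite ffunE.
by rewrite (fr_lap_mulc fr oU UW _ (sLf A) Ux) exprS mulN1r mulNr.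
Qed.

(** The weights are real, so covariance can be used on each Clifford coordinate; both sides carry
    the same sign [(-1) ^+ k]. *)
Lemma lap_covariant_slice_dirac phi nu k V f x :
  lap_covariant phi nu -> open V -> V `<=` W -> cl_smooth k.*2 V f -> W x -> V (phi x) ->
  iter k.*2 G f (phi x) = nu x ^+ (p + 1 + k.*2) *:
    iter k.*2 G (fun z => nu z ^ (- p%:Z - 1 + k.*2%:Z) *: f (phi z)) x.
Proof.
move=> cov oV VW sf Wx Vx.
pose U := [set x | W x /\ V (phi x)].
have oU : open U by have [] := cov k V _ oV VW (sf finset.set0).
have UW : U `<=` W by move=> z [].
have gE A : (fun z => (nu z ^ (- p%:Z - 1 + k.*2%:Z) *: f (phi z)) A) =
    (fun z => nu z ^ covariance_weight p k * f (phi z) A).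
  by apply/funext => z; rewrite ffunE.
rewrite (iter_slice_dirac_even oV VW sf Vx) (@iter_slice_dirac_even U) //.
  apply/ffunP => A; rewrite !ffunE gE.
  have [_ _ e] := cov k V _ oV VW (sf A).
  by rewrite e // [RHS]mulrCA.
by move=> A; rewrite gE; have [] := cov k V _ oV VW (sf A).
Qed.

End SliceDirac.

(** * The group GRAV *)

Section GravWords.
Variables (R : realType) (p q : nat).
Local Notation Cl := (clifford R (p + q)).
Implicit Types (M N g : 'M[Cl]_2) (x z : 'rV[R]_(p + q)) (u v : Cl).
Local Notation W := (@slice_domain R p q).

Inductive GRAV_gen : 'M[Cl]_2 -> Prop :=
| Gen_translation (b : 'rV[R]_p) : GRAV_gen (mx2 1 (cl_vec (row_mx b 0)) 0 1)
| Gen_dilation (c : R) : c != 0 -> GRAV_gen (mx2 c%:A 0 0 (c^-1)%:A)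
| Gen_sphere (a : 'rV[R]_q) : cl_norm (cl_vec (row_mx 0 a : 'rV[R]_(p + q))) = 1 ->
    GRAV_gen (mx2 (cl_vec (row_mx 0 a)) 0 0 (cl_vec (row_mx 0 a))^-1)
| Gen_inversion : GRAV_gen (mx2 0 1 (-1) 0).

(** Words replace the constructors for products and inverses of [GRAV]. A generator is added on the
    left, that is, as the map applied last, which suits an induction following the image of a
    point. *)
Inductive GRAV_word : 'M[Cl]_2 -> Prop :=
| Word_one : GRAV_word 1%:M
| Word_cons g M : GRAV_gen g -> GRAV_word M -> GRAV_word (g *m M).

Lemma mx2_mul (a b c d a' b' c' d' : Cl) : mx2 a b c d *m mx2 a' b' c' d' =
  mx2 (a * a' + b * c') (a * b' + b * d') (c * a' + d * c') (c * b' + d * d').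
Proof.
apply/matrixP => i j; rewrite !mxE !big_ord_recl big_ord0 !mxE /= addr0.
by case: ifP => _; case: ifP => _.
Qed.

Lemma mx2_one : 1%:M = mx2 1 0 0 1 :> 'M[Cl]_2.
Proof. by apply/matrixP => -[[|[|i]] Hi] [[|[|j]] Hj] //; rewrite !mxE. Qed.

Lemma GRAV_word_gen g : GRAV_gen g -> GRAV_word g.
Proof. by move=> Gg; rewrite -[g]mulmx1; apply: Word_cons => //; exact: Word_one. Qed.

Lemma GRAV_word_mul M N : GRAV_word M -> GRAV_word N -> GRAV_word (M *m N).
Proof.
elim=> [|g M' Gg _ IHM] WN; first by rewrite mul1mx.
by rewrite -mulmxA; apply: Word_cons => //; exact: IHM.
Qed.

Lemma unit_sphere_sqr (a : 'rV[R]_q) : cl_norm (cl_vec (row_mx 0 a : 'rV[R]_(p + q))) = 1 ->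
  \sum_j a 0 j ^+ 2 = 1 /\
  cl_vec (row_mx 0 a : 'rV[R]_(p + q)) * cl_vec (row_mx 0 a : 'rV[R]_(p + q)) = -1.
Proof.
rewrite cl_norm_vec => a1.
have N1 : rv_sqnorm (row_mx 0 a : 'rV[R]_(p + q)) = 1.
  rewrite -[LHS]sqr_sqrtr ?a1 ?expr1n //; apply: sumr_ge0 => j _; exact: sqr_ge0.
split; last by rewrite cl_vec_sqr N1 scaleN1r.
rewrite -N1 /rv_sqnorm big_split_ord /= [X in _ = X + _]big1 ?add0r => [|j _].
  by apply: eq_bigr => j _; rewrite row_mxEr.
by rewrite row_mxEl mxE expr0n.
Qed.

Lemma inv_of_sqrN1 v : v * v = -1 -> v^-1 = - v.
Proof.
move=> vv; have vNv : v * - v = 1 by rewrite mulrN vv opprK.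
have uv : v \is a GRing.unit by apply/unitrP; exists (- v); rewrite mulNr mulrN vv opprK.
by rewrite -[LHS]mulr1 -vNv mulKr.
Qed.

Lemma cl_scale_unit (k : R) v : k != 0 -> v \is a GRing.unit -> k *: v \is a GRing.unit.
Proof.
move=> k0 uv; apply/unitrP; exists (k^-1 *: v^-1).
rewrite -!scalerAl -!scalerAr !scalerA mulVf // mulfV // !scale1r.
by rewrite mulVr // mulrV.
Qed.

Lemma GRAV_gen_inv g : GRAV_gen g ->
  exists2 N, GRAV_word N & g *m N = 1%:M /\ N *m g = 1%:M.
Proof.
case=> [b|c c0|a a1|].
- exists (mx2 1 (cl_vec (row_mx (- b) 0)) 0 1); first exact/GRAV_word_gen/Gen_translation.
  have -> : cl_vec (row_mx (- b) 0 : 'rV[R]_(p + q)) = - cl_vec (row_mx b 0).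
    by rewrite -cl_vecN opp_row_mx oppr0.
  by rewrite !mx2_mul mx2_one !(mulr1, mul1r, mulr0, mul0r, addr0, add0r) addNr subrr.
- exists (mx2 (c^-1)%:A 0 0 (c^-1^-1)%:A).
    by apply/GRAV_word_gen/Gen_dilation; rewrite invr_eq0.
  rewrite !mx2_mul mx2_one !(mulr0, mul0r, addr0, add0r) -!scalerAl !mul1r !scalerA.
  by rewrite invrK mulfV // mulVf // scale1r.
- have [_ aa] := unit_sphere_sqr a1.
  set v : Cl := cl_vec _ in a1 aa *.
  have vE : cl_vec (row_mx 0 (- a) : 'rV[R]_(p + q)) = - v.
    by rewrite -cl_vecN opp_row_mx oppr0.
  exists (mx2 (cl_vec (row_mx 0 (- a))) 0 0 (cl_vec (row_mx 0 (- a)))^-1).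
    by apply/GRAV_word_gen/Gen_sphere; rewrite vE -scaleN1r cl_norm_scale normrN normr1 mul1r.
  rewrite !mx2_mul mx2_one !(mulr0, mul0r, addr0, add0r) vE (inv_of_sqrN1 aa).
  have -> : (- v)^-1 = v by rewrite inv_of_sqrN1 ?opprK // mulrNN.
  by rewrite !mulrN !mulNr aa opprK.
(* This matrix has square [-1], so its cube is its inverse. *)
- exists (mx2 0 1 (-1) 0 *m (mx2 0 1 (-1) 0 *m mx2 0 1 (-1) 0)).
    do 2 (apply: Word_cons; first exact: Gen_inversion).
    exact/GRAV_word_gen/Gen_inversion.
  rewrite !mx2_mul !(mulr1, mul1r, mulr0, mul0r, addr0, add0r, mulrNN, mulrN, mulNr).
  by rewrite mx2_one !opprK !oppr0.
Qed.

Lemma GRAV_word_inv M : GRAV_word M ->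
  exists2 N, GRAV_word N & M *m N = 1%:M /\ N *m M = 1%:M.
Proof.
elim=> [|g M' Gg _ [N' WN' [MN NM]]].
  by exists 1%:M; [exact: Word_one|rewrite mul1mx].
have [N WN [gN Ng]] := GRAV_gen_inv Gg.
exists (N' *m N); first exact: GRAV_word_mul.
split; first by rewrite mulmxA -(mulmxA g) MN mulmx1.
by rewrite mulmxA -(mulmxA N') Ng mulmx1.
Qed.

Lemma GRAV_is_word M : GRAV M -> GRAV_word M.
Proof.
elim=> {M} [b|c c0|a a1|||M N _ WM _ WN|M N _ WM MN NM].
- exact/GRAV_word_gen/Gen_translation.
- exact/GRAV_word_gen/Gen_dilation.
- exact/GRAV_word_gen/Gen_sphere.
- exact/GRAV_word_gen/Gen_inversion.
- exact: Word_one.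
- exact: GRAV_word_mul.
(* An inverse is unique: [N = N M N' = N']. *)
have [N' WN' [MN' _]] := GRAV_word_inv WM.
by rewrite (_ : N = N') // -[N]mulmx1 -MN' mulmxA NM mul1mx.
Qed.

(** Numerator and denominator are homogeneous coordinates of the image, on which matrix products act
    linearly; no intermediate quotient has to be formed. *)
Definition mx2_num M x : Cl := M ord0 ord0 * cl_vec x + M ord0 ord_max.
Definition mx2_den M x : Cl := M ord_max ord0 * cl_vec x + M ord_max ord_max.

Lemma mx2_num_mul g M x :
  mx2_num (g *m M) x = g ord0 ord0 * mx2_num M x + g ord0 ord_max * mx2_den M x.
Proof.
rewrite /mx2_num /mx2_den !mxE !big_ord_recl !big_ord0 !addr0.
rewrite (_ : lift ord0 ord0 = ord_max); last exact: val_inj.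
by rewrite mulrDl !mulrDr !mulrA addrACA.
Qed.

Lemma mx2_den_mul g M x :
  mx2_den (g *m M) x = g ord_max ord0 * mx2_num M x + g ord_max ord_max * mx2_den M x.
Proof.
rewrite /mx2_num /mx2_den !mxE !big_ord_recl !big_ord0 !addr0.
rewrite (_ : lift ord0 ord0 = ord_max); last exact: val_inj.
by rewrite mulrDl !mulrDr !mulrA addrACA.
Qed.

(** Multiplying [a z = - 2 <a, z> - z a] by [a] on the right and using [a^2 = -1] gives
    [z - 2 <a, z> a]. *)
Lemma cl_vec_reflection (a : 'rV[R]_q) z :
  cl_norm (cl_vec (row_mx 0 a : 'rV[R]_(p + q))) = 1 ->
  cl_vec (slice_reflection a z) = cl_vec (row_mx 0 a) * cl_vec z * cl_vec (row_mx 0 a).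
Proof.
move=> /unit_sphere_sqr[_ aa]; rewrite cl_vecD cl_vecN cl_vecZ.
have := cl_vec_anticomm (row_mx 0 a : 'rV[R]_(p + q)) z.
rewrite big_split_ord /= big1 ?add0r => [|j _]; last by rewrite row_mxEl mxE mul0r.
under eq_bigr do rewrite row_mxEr mulrC.
move=> /(canRL (addrK _)) ->; rewrite mulrBl -mulrA aa mulrN1 opprK addrC.
by rewrite -scalerAl mul1r scaleNr.
Qed.

(** The point [z] is given by homogeneous coordinates [(z v, v)] with any unit [v], because inside a
    word the denominator inherited from the earlier generators is a general Clifford element. The
    last clause is the cocycle rule for its norm. *)
Lemma gen_action g : GRAV_gen g -> exists psi eta,
  [/\ lap_covariant psi eta, forall z, W z -> W (psi z) &
   forall z v, W z -> v \is a GRing.unit ->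
     let u' := g ord0 ord0 * (cl_vec z * v) + g ord0 ord_max * v in
     let v' := g ord_max ord0 * (cl_vec z * v) + g ord_max ord_max * v in
     [/\ v' \is a GRing.unit, u' = cl_vec (psi z) * v' & cl_norm v' = eta z * cl_norm v]].
Proof.
case=> [b|c c0|a a1|].
- exists (slice_translation b), (fun=> 1); split; first exact: covariant_translation.
    by move=> z /slice_domainE Wz; apply/slice_domainE; rewrite sqradius_translation.
  move=> z v Wz uv; rewrite !mxE /= !mul0r !mul1r add0r.
  by split=> //; rewrite cl_vecD mulrDl.
- exists (fun x => c ^+ 2 *: x), (fun=> `|c^-1|); split; first exact: covariant_dilation.
    by move=> z Wz; apply: (slice_frame_scale Wz _).1; rewrite exprn_even_gt0.
  move=> z v Wz uv; rewrite !mxE /= !mul0r addr0 add0r -!scalerAl !mul1r; split.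
  + by apply: cl_scale_unit; rewrite ?invr_eq0.
  + by rewrite cl_vecZ -scalerAl -scalerAr scalerA expr2 mulfK.
  + by rewrite cl_norm_scale.
- have [a1' aa] := unit_sphere_sqr a1.
  exists (slice_reflection a), (fun=> 1); split; first exact: covariant_reflection.
    by move=> z /slice_domainE Wz; apply/slice_domainE; rewrite sqradius_reflection.
  (* As [a^-1 = - a], the new denominator is [- a v], and [(a z a) (- a v) = a z v]. *)
  move=> z v Wz uv; rewrite !mxE /= !mul0r addr0 add0r (inv_of_sqrN1 aa) mulNr; split.
  + rewrite unitrN unitrMl //; apply/unitrP; exists (- cl_vec (row_mx 0 a)).
    by rewrite mulNr mulrN aa opprK.
  + by rewrite cl_vec_reflection // -2!mulrA mulrN [in RHS](mulrA _ _ v) aa mulN1r opprK.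
  + by rewrite -scaleN1r cl_norm_scale normrN normr1 mul1r cl_norm_vec_mul -cl_norm_vec a1.
- have fr := @slice_parallel_frame R p q.
  have N0 z : W z -> 0 < rv_sqnorm z.
    by move=> Wz; apply: sqnorm_gt0; exact: (fr_neq0 fr Wz).
  exists (@rv_inversion R _), (fun z => Num.sqrt (rv_sqnorm z)); split.
  + exact: lap_covariant_inversion.
  + by move=> z Wz; apply: (slice_frame_scale Wz _).1; rewrite invr_gt0 N0.
  (* The new pair is [(v, - z v)], and [(z / |z|^2) (- z v) = v] because [z^2 = - |z|^2]. *)
  move=> z v Wz uv; rewrite !mxE /= !mul0r addr0 add0r mul1r mulN1r; split.
  + by rewrite unitrN unitrMl // cl_vec_unit // (fr_neq0 fr).
  + rewrite cl_vecZ -scalerAl mulrN mulrA cl_vec_sqr -scalerAl mul1r -scalerN scalerN.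
    by rewrite scaleNr opprK scalerA mulVf ?scale1r // gt_eqF // N0.
  + by rewrite -scaleN1r cl_norm_scale normrN normr1 mul1r cl_norm_vec_mul.
Qed.

(** Carrying [W (phi x)] and the invertibility of the denominator through the induction supplies the
    hypotheses of [gen_action] for the next generator. *)
Lemma word_action M : GRAV_word M -> exists phi nu, lap_covariant phi nu /\
  forall x, W x -> [/\ W (phi x), mx2_den M x \is a GRing.unit,
    mx2_num M x = cl_vec (phi x) * mx2_den M x & cl_norm (mx2_den M x) = nu x].
Proof.
elim=> [|g M' Gg _ [phi [nu [cov act]]]].
  exists (fun x => x), (fun=> 1); split.
    apply: lap_covariant_affine => // [k m|i m x Wx]; first exact: smooth_coord.
    by rewrite [LHS]derive_coord expr1n invr1 mul1r.
  move=> x Wx; rewrite /mx2_num /mx2_den !mxE /= mul0r add0r mul1r addr0 mulr1.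
  by split=> //; [exact: unitr1|exact: cl_norm1].
have [psi [eta [covg Wg actg]]] := gen_action Gg.
exists (fun x => psi (phi x)), (fun x => eta (phi x) * nu x); split.
  by apply: lap_covariant_comp => // x /act[].
move=> x Wx; have [Wp uv num den] := act x Wx.
have [uv' num' den'] := actg _ _ Wp uv.
rewrite mx2_num_mul mx2_den_mul num; split=> //; first exact: Wg.
by rewrite den' den.
Qed.

(* Homogeneous coordinates of a point of the boundary R^p, the second case being
   the point at infinity. *)
Definition boundary_pair u v :=
  (exists w : 'rV[R]_(p + q), [/\ rsubmx w = 0, v \is a GRing.unit & u = cl_vec w * v]) \/
  (v = 0 /\ u \is a GRing.unit).

(** The boundary with its point at infinity is preserved. The inversion exchanges [0] and infinity,
    so an intermediate image may be infinite even if the final one is not, which is why both forms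
    of the pair are followed. *)
Lemma gen_boundary g u v : GRAV_gen g -> boundary_pair u v ->
  boundary_pair (g ord0 ord0 * u + g ord0 ord_max * v)
                (g ord_max ord0 * u + g ord_max ord_max * v).
Proof.
case=> [b|c c0|a a1|] B; rewrite !mxE /= !mul0r ?mul1r ?addr0 ?add0r ?mulN1r.
- case: B => [[w [w0 uv ->]]|[-> uu]]; last by right; rewrite mulr0 addr0.
  left; exists (w + row_mx b 0); split=> //; first by rewrite linearD /= w0 row_mxKr addr0.
  by rewrite cl_vecD mulrDl.
- rewrite -!scalerAl !mul1r.
  case: B => [[w [w0 uv ->]]|[-> uu]]; last by right; rewrite scaler0; split=> //; exact: cl_scale_unit.
  left; exists (c ^+ 2 *: w); split; first by rewrite linearZ /= w0 scaler0.
    by apply: cl_scale_unit; rewrite ?invr_eq0.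
  by rewrite cl_vecZ -scalerAl -scalerAr scalerA expr2 mulfK.
- have [_ aa] := unit_sphere_sqr a1; rewrite (inv_of_sqrN1 aa) mulNr.
  have ua : cl_vec (row_mx 0 a : 'rV[R]_(p + q)) \is a GRing.unit.
    by apply/unitrP; exists (- cl_vec (row_mx 0 a)); rewrite mulNr mulrN aa opprK.
  case: B => [[w [w0 uv ->]]|[-> uu]]; last first.
    by right; rewrite mulr0 oppr0 unitrMl.
  left; exists (slice_reflection a w); split.
  + rewrite /slice_reflection linearB linearZ /= w0 row_mxKr sub0r big1 ?mulr0 ?scale0r ?oppr0 // => j _.
    by move/rowP/(_ j): w0; rewrite !mxE => ->; rewrite mul0r.
  + by rewrite unitrN unitrMl.
  + by rewrite cl_vec_reflection // -2!mulrA mulrN [in RHS](mulrA _ _ v) aa mulN1r opprK.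
- case: B => [[w [w0 uv ->]]|[-> uu]]; last first.
    by left; exists 0; rewrite linear0 cl_vec0 mul0r unitrN.
  have [->|wn0] := eqVneq w 0; first by right; rewrite cl_vec0 mul0r oppr0.
  left; exists (rv_inversion w); split; first by rewrite linearZ /= w0 scaler0.
    by rewrite unitrN unitrMl // cl_vec_unit.
  rewrite cl_vecZ -scalerAl mulrN mulrA cl_vec_sqr -scalerAl mul1r.
  by rewrite scaleNr opprK scalerA mulVf ?scale1r // gt_eqF // sqnorm_gt0.
Qed.

Lemma word_boundary M x : GRAV_word M -> rsubmx x = 0 ->
  boundary_pair (mx2_num M x) (mx2_den M x).
Proof.
move=> WM x0; elim: WM => [|g M' Gg _ IHM].
  left; exists x; rewrite /mx2_num /mx2_den !mxE /= mul0r add0r mul1r addr0 mulr1.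
  by split=> //; exact: unitr1.
by rewrite mx2_num_mul mx2_den_mul; exact: gen_boundary.
Qed.

End GravWords.

Theorem theorem5 (R : realType) (p q l : nat)
    (hp : (1 <= p)%N) (hq : (1 <= q)%N) (hl : (0 < l)%N) (hl_even : ~~ odd l)
    (a b c d : clifford R (p + q)) (hM : GRAV (mx2 a b c d))
    (U : set 'rV[R]_(p + q)) (hU : is_domain U)
    (hUp : U `<=` ~` @Rp_subset R p q)
    (f : 'rV[R]_(p + q) -> clifford R (p + q)) (hf : cl_is_Ck l U f)
    (x : 'rV[R]_(p + q))
    (hx : c * cl_vec x + d \is a GRing.unit)
    (hy : U (moebius a b c d x)) :
  iter l (@slice_dirac R p q) f (moebius a b c d x) =
  cl_norm (c * cl_vec x + d) ^+ (p + 1 + l) *: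
    iter l (@slice_dirac R p q)
      (fun z => cl_norm (c * cl_vec z + d) ^ (- p%:Z - 1 + l%:Z) *:
                f (moebius a b c d z)) x.
Proof.
have [oU _ _] := hU; have wM := GRAV_is_word hM.
have numE z : mx2_num (mx2 a b c d) z = a * cl_vec z + b by rewrite /mx2_num !mxE.
have denE z : mx2_den (mx2 a b c d) z = c * cl_vec z + d by rewrite /mx2_den !mxE.
(* A point of [R^p] would have its image either in [R^p], which [U] avoids, or at infinity, which
   the invertibility of [c x + d] rules out. *)
have Wx : slice_domain x.
  move=> x0; have := word_boundary wM x0; rewrite numE denE.
  case=> [[w [w0 uv e]]|[v0 _]]; last by rewrite v0 unitr0 in hx.
  by apply: (hUp _ hy); rewrite /moebius e mulrK // cl_vecK.
have [phi [nu [cov act]]] := word_action wM.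
have phiE z : slice_domain z -> moebius a b c d z = phi z.
  move=> /act[_ ud e _]; move: ud e; rewrite denE numE /moebius => ud ->.
  by rewrite mulrK // cl_vecK.
have nuE z : slice_domain z -> cl_norm (c * cl_vec z + d) = nu z.
  by move=> /act[_ _ _ <-]; rewrite denE.
have lE : l = l./2.*2 by rewrite -[LHS]odd_double_half (negPf hl_even).
(* The Möbius map and [|c z + d|] are identified with [phi] and [nu] only off [R^p]; that set is
   open, so the iterated operator at [x] sees no difference. *)
rewrite (iter_slice_dirac_eq l (@open_slice_domain R p q) Wx
  (g := fun z => nu z ^ (- p%:Z - 1 + l%:Z) *: f (phi z))); last first.
  by move=> z Wz; rewrite phiE // nuE.
rewrite phiE // in hy *; rewrite nuE // lE.
apply: (lap_covariant_slice_dirac cov oU) => // A.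
by apply: is_Ck_smooth => //; rewrite -lE; exact: hf.
Qed.
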